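(* Let $F,F_1,F_2$ be three closed surfaces, let $\omega_1,\omega_2$ be symplectic forms on $F_1,F_2$, and equip $F_1\times F_2$ with $\omega_1\times(-\omega_2)$. Suppose that $g=(g_1,g_2):F\to F_1\times F_2$ is a Lagrangian correspondence from $F_1$ to $F_2$ and that both $g_1:F\to F_1$ and $g_2:F\to F_2$ are covering maps. Then any two immersed curves $L_1\looparrowright F_1$ and $L_2\looparrowright F_2$ are composable with $F\looparrowright F_1\times F_2$, and there is a canonical bijection between the points of $(L_1\circ F)\times_{F_2}L_2$ and the points of $L_1\times_{F_1}(F\circ L_2)$. Moreover, this bijection can be extended to a bijection between the bigons of $(L_1\circ F)\times_{F_2}L_2$ and the bigons of $L_1\times_{F_1}(F\circ L_2)$.
   Context: $\omega_1\times(-\omega_2)$ means $\mathrm{pr}_1^*\omega_1-\mathrm{pr}_2^*\omega_2$. A Lagrangian correspondence from $F_1$ to $F_2$ is a Lagrangian immersion into $(F_1\times F_2,\omega_1\times(-\omega_2))$. Any immersed curve in a symplectic surface is Lagrangian. Fiber product: for maps $l:L\to X$, $l':L'\to X$, $L\times_XL'=\{(x,x')\in L\times L' : l(x)=l'(x')\}$; its elements are called intersections. Composition: let $f_1:L_1\to F_1$, $f_2:L_2\to F_2$ be immersed curves. $L_1\circ F:=\{(x,y)\in L_1\times F: f_1(x)=g_1(y)\}$ with the map $(x,y)\mapsto g_2(y)\in F_2$; $F\circ L_2:=\{(y,z)\in F\times L_2: g_2(y)=f_2(z)\}$ with the map $(y,z)\mapsto g_1(y)\in F_1$. $L_1$ and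 $F$ are composable if $f_1\times g:L_1\times F\to F_1\times F_1\times F_2$ is transverse to $\Delta_{F_1}\times F_2$, where $\Delta_{F_1}$ is the diagonal; $F$ and $L_2$ are composable if $g\times f_2:F\times L_2\to F_1\times F_2\times F_2$ is transverse to $F_1\times\Delta_{F_2}$. In these cases $L_1\circ F\looparrowright F_2$ and $F\circ L_2\looparrowright F_1$ are immersed curves. ''Canonical bijection'' is the one coming from the identification of both sets with $\{(x,y,z)\in L_1\times F\times L_2: f_1(x)=g_1(y),\ g_2(y)=f_2(z)\}$. Bigon: for Lagrangian immersions $L\looparrowright X$, $L'\looparrowright X$ (here $X$ is a surface and $L,L'$ are curves), a bigon of $L\times_XL'$ is an oriented immersed unit disc in $X$ such that: (i) the map on the upper half of the boundary unit circle lifts to $L$ and the map on the lower half lifts to $L'$; (ii) the boundary points $(\pm1,0)$ are mapped to two different points $x,y\in L\times_XL'$ (the bigon is said to connect $x$ and $y$); (iii) near $x$ and $y$ the image of the disc is a convex corner, i.e. locally one of the four quadrants cut out by the branches of $L$ and $L'$ crossing there. That the bijection of points ''extends'' to bigons means that a bigon connecting $x$ and $y$ corresponds to a bigon connecting the points corresponding to $x$ and $y$. *)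

(* Defs.v *)
From HB Require Import structures.
From mathcomp Require Import all_boot all_order all_algebra.
From mathcomp Require Import all_classical all_reals all_analysis.

Set Implicit Arguments.
Unset Strict Implicit.
Unset Printing Implicit Defensive.

Import Order.TTheory GRing.Theory Num.Theory.
Import numFieldNormedType.Exports.

Local Open Scope classical_set_scope.
Local Open Scope ring_scope.

(* [Cn n A f]: f is C^n on the open set A.  The recursion on directional
   derivatives is the usual notion when V has finite dimension, which is the
   case of every model space below (built from R by products). *)
Fixpoint Cn (R : realType) (V W : normedModType R) (n : nat) (A : set V)
    (f : V -> W) : Prop :=
  match n with
  | 0 => forall x, A x -> {for x, continuous f}
  | n'.+1 => (forall x, A x -> differentiable f x) /\
             (forall v, Cn n' A ('D_v f))
  end.

Definition Cinfty (R : realType) (V W : normedModType R) (A : set V)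
    (f : V -> W) : Prop := forall n, Cn n A f.

Lemma open_setX (T T' : topologicalType) (A : set T) (B : set T') :
  open A -> open B -> open (A `*` B).
Proof.
rewrite !openE => oA oB [x y] [Ax By].
by exists (A, B) => //; split; [exact: oA|exact: oB].
Qed.

Section CnLemmas.
Context {R : realType}.

Lemma near_eq_differentiable (V W : normedModType R) (f g : V -> W) (x : V) :
  (\forall y \near x, f y = g y) -> differentiable f x -> differentiable g x.
Proof.
move=> fg df.
have fgx : f x = g x by exact: nbhs_singleton fg.
have E : g \o shift x = cst (g x) + 'd f x +o_ 0 id.
  apply/eqaddoP => e e0.
  have /eqaddoP/(_ e e0) := diff_locally df.
  move: fg; rewrite (near_shift 0) subr0 => fg.
  apply: filterS2 fg => y /= fgy.
  by rewrite !fctE /= -fgx -fgy.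
apply/diff_locallyP.
have -> : 'd g x = 'd f x :> (V -> W).
  by apply: diff_unique E; exact: diff_continuous df.
by split=> //; exact: diff_continuous df.
Qed.

Lemma Cn_ext (V W : normedModType R) n (A : set V) (f g : V -> W) :
  open A -> {in A, f =1 g} -> Cn n A f -> Cn n A g.
Proof.
move=> oA; elim: n f g => [|n IH] f g fg.
  move=> cf x Ax.
  have fgx : \forall y \near x, f y = g y.
    by near=> y; apply: fg; apply/mem_set; near: y; exact: open_nbhs_nbhs.
  have := cf x Ax; rewrite /prop_for /continuous_at (fg x (mem_set Ax)) => cfx.
  by apply: cvg_trans cfx; exact: near_eq_cvg.
move=> [df Df]; split.
  move=> x Ax; apply: near_eq_differentiable (df x Ax).
  by near=> y; apply: fg; apply/mem_set; near: y; exact: open_nbhs_nbhs.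
move=> v; apply: IH (Df v) => x /set_mem Ax.
apply: near_eq_derive.
by near=> y; apply: fg; apply/mem_set; near: y; exact: open_nbhs_nbhs.
Unshelve. all: by end_near. Qed.


Lemma differentiable_mapX (V V' W W' : normedModType R) (f : V -> W)
    (g : V' -> W') (x : V * V') :
  differentiable f x.1 -> differentiable g x.2 ->
  is_diff x (fun z : V * V' => (f z.1, g z.2))
            (fun v => ('d f (x.1) v.1, 'd g (x.2) v.2)).
Proof.
move=> df dg.
pose p1 : {linear (V * V')%type -> V} := (fst : V * V' -> V).
pose p2 : {linear (V * V')%type -> V'} := (snd : V * V' -> V').
have c1 : continuous p1 by move=> z; exact: cvg_fst.
have c2 : continuous p2 by move=> z; exact: cvg_snd.
have d1 : differentiable (f \o p1) x.
  by apply: differentiable_comp => //; exact: linear_differentiable.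
have d2 : differentiable (g \o p2) x.
  by apply: differentiable_comp => //; exact: linear_differentiable.
apply: DiffDef; first exact: differentiable_pair d1 d2.
have E1 : 'd (f \o p1) x = 'd f (p1 x) \o p1 :> (_ -> _).
  by rewrite (diff_comp (linear_differentiable _ c1)) // diff_lin.
have E2 : 'd (g \o p2) x = 'd g (p2 x) \o p2 :> (_ -> _).
  by rewrite (diff_comp (linear_differentiable _ c2)) // diff_lin.
by rewrite (diff_pair d1 d2); apply/funext => v; rewrite E1 E2.
Qed.

Lemma Cn_mapX (V V' W W' : normedModType R) n (A : set V) (B : set V')
    (f : V -> W) (g : V' -> W') : open A -> open B ->
  Cn n A f -> Cn n B g ->
  Cn n (A `*` B) (fun z : V * V' => (f z.1, g z.2)).
Proof.
move=> oA oB; elim: n f g => [|n IH] f g /=.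
  move=> cf cg [x y] [/= Ax By].
  apply: cvg_pair.
    by apply: cvg_comp; [exact: cvg_fst|exact: cf].
  by apply: cvg_comp; [exact: cvg_snd|exact: cg].
move=> [df Df] [dg Dg]; split.
  by move=> z [Az Bz]; have [] := differentiable_mapX (df _ Az) (dg _ Bz).
move=> v; apply: (Cn_ext _ _ (IH _ _ (Df v.1) (Dg v.2))).
  exact: open_setX.
move=> z /set_mem [Az Bz].
have [d E] := differentiable_mapX (df _ Az) (dg _ Bz).
rewrite (deriveE _ d) E (deriveE _ (df _ Az)) (deriveE _ (dg _ Bz)).
by [].
Qed.

Lemma Cn_id (V : normedModType R) n (A : set V) : open A -> Cn n A id.
Proof.
move=> oA; case: n => [|n] /=; first by move=> x _; exact: cvg_id.
split; first by [].
move=> v; have H : Cn n A (cst v).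
  elim: n v => [|n IH] v /=; first by move=> x _; exact: cvg_cst.
  split=> [x _|u]; first exact: differentiable_cst.
  apply: (Cn_ext oA _ (IH 0)) => x _.
  by rewrite deriveE // diff_cst.
apply: Cn_ext H => // x _.
by rewrite deriveE // diff_val.
Qed.

End CnLemmas.

(* [cinv] is only meaningful on [ccod], and [cto] on [cdom]. *)
Record chart (R : realType) (E : normedModType R) (T : topologicalType) :=
  Chart {
    cdom : set T;
    ccod : set E;
    cto : T -> E;
    cinv : E -> T;
    cdom_open : open cdom;
    ccod_open : open ccod;
    cto_cod : forall p, cdom p -> ccod (cto p);
    cinv_dom : forall x, ccod x -> cdom (cinv x);
    cinvK : forall p, cdom p -> cinv (cto p) = p;
    ctoK : forall x, ccod x -> cto (cinv x) = x;
    cto_cont : forall p, cdom p -> {for p, continuous cto};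
    cinv_cont : forall x, ccod x -> {for x, continuous cinv} }.

Definition compatible (R : realType) (E : normedModType R)
    (T : topologicalType) (c c' : chart E T) : Prop :=
  Cinfty (ccod c `&` cinv c @^-1` cdom c') (cto c' \o cinv c).

(* A smooth atlas with model space E, indexed by the points of the manifold:
   every smooth manifold has an atlas of this form.  The preferred chart at p
   identifies the tangent space at p with E.  Boundaryless by construction;
   separation and countability axioms are stated separately. *)
Record manifold (R : realType) (E : normedModType R) := Manifold {
  msort :> topologicalType;
  chart_at : msort -> chart E msort;
  chart_at_dom : forall p, cdom (chart_at p) p;
  chart_at_compat : forall p q, compatible (chart_at p) (chart_at q) }.

(* Membership in the maximal atlas. *)
Definition smooth_chart (R : realType) (E : normedModType R)
    (M : manifold E) (c : chart E M) : Prop :=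
  forall p, compatible c (chart_at p) /\ compatible (chart_at p) c.

Section ModelManifold.
Context {R : realType} (E : normedModType R).

Definition model_chart : chart E E.
Proof.
refine (@Chart R E E setT setT id id openT openT _ _ _ _ _ _) => //;
  by move=> x _; exact: cvg_id.
Defined.

Lemma model_compat : compatible model_chart model_chart.
Proof.
move=> n; apply: (@Cn_id R E n); rewrite preimage_setT setIT; exact: openT.
Qed.

Definition model_manifold : manifold E :=
  @Manifold R E E (fun=> model_chart) (fun=> I) (fun _ _ => model_compat).

End ModelManifold.

Section ProductManifold.
Context {R : realType} {E E' : normedModType R}.

Section ProductChart.
Context {T T' : topologicalType} (c : chart E T) (c' : chart E' T').

Definition prod_chart : chart (E * E')%type (T * T')%type.
Proof.
refine (@Chart R (E * E')%type (T * T')%type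
  (cdom c `*` cdom c') (ccod c `*` ccod c')
  (fun p => (cto c p.1, cto c' p.2)) (fun x => (cinv c x.1, cinv c' x.2))
  (open_setX (cdom_open c) (cdom_open c'))
  (open_setX (ccod_open c) (ccod_open c')) _ _ _ _ _ _).
- by move=> p [? ?]; split; exact: cto_cod.
- by move=> p [? ?]; split; exact: cinv_dom.
- by move=> [p q] [? ?]; rewrite /= !cinvK.
- by move=> [p q] [? ?]; rewrite /= !ctoK.
- move=> [p q] [/= dp dq]; apply: cvg_pair.
    by apply: cvg_comp; [exact: cvg_fst|exact: cto_cont].
  by apply: cvg_comp; [exact: cvg_snd|exact: cto_cont].
- move=> [p q] [/= dp dq]; apply: cvg_pair.
    by apply: cvg_comp; [exact: cvg_fst|exact: cinv_cont].
  by apply: cvg_comp; [exact: cvg_snd|exact: cinv_cont].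
Defined.

End ProductChart.

Lemma overlap_open (V : normedModType R) (T : topologicalType)
    (c d : chart V T) : open (ccod c `&` cinv c @^-1` cdom d).
Proof.
rewrite openE => x [cx dx]; apply: filterI.
  exact: open_nbhs_nbhs (conj (ccod_open c) cx).
apply: (cinv_cont cx); exact: open_nbhs_nbhs (conj (cdom_open d) dx).
Qed.

Lemma prod_compat (T T' : topologicalType) (c d : chart E T)
    (c' d' : chart E' T') : compatible c d -> compatible c' d' ->
  compatible (prod_chart c c') (prod_chart d d').
Proof.
move=> h h' n.
have := Cn_mapX (overlap_open c d) (overlap_open c' d') (h n) (h' n).
rewrite (_ : _ `*` _ = ccod (prod_chart c c') `&`
  cinv (prod_chart c c') @^-1` cdom (prod_chart d d')) //.
by apply/seteqP; split=> -[x y] [] [? ?] [? ?].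
Qed.

Definition prod_manifold (M : manifold E) (N : manifold E') :
    manifold (E * E')%type :=
  @Manifold R (E * E')%type (M * N)%type
    (fun p => prod_chart (chart_at p.1) (chart_at p.2))
    (fun p => conj (chart_at_dom p.1) (chart_at_dom p.2))
    (fun p q => prod_compat (chart_at_compat p.1 q.1)
                            (chart_at_compat p.2 q.2)).

End ProductManifold.

Section SmoothMaps.
Context {R : realType} {E E' : normedModType R}.
Context {M : manifold E} {N : manifold E'}.

(* To be used for open A. *)
Definition smooth_on (A : set M) (f : M -> N) : Prop :=
  (forall p, A p -> {for p, continuous f}) /\
  (forall p q, let c := chart_at p in let d := chart_at q in
     Cinfty (ccod c `&` cinv c @^-1` (A `&` f @^-1` cdom d))
            (cto d \o f \o cinv c)).

Definition smooth (f : M -> N) : Prop := smooth_on setT f.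

Definition tangent_map (f : M -> N) (p : M) : E -> E' :=
  'd (cto (chart_at (f p)) \o f \o cinv (chart_at p)) (cto (chart_at p) p).

Definition immersion (f : M -> N) : Prop :=
  smooth f /\ forall p, injective (tangent_map f p).

End SmoothMaps.

(* Covering map in the smooth category: every sheet is mapped diffeomorphically onto the evenly
   covered open set U, s being the inverse diffeomorphism. *)
Definition covering_map (R : realType) (E E' : normedModType R)
    (M : manifold E) (N : manifold E') (f : M -> N) : Prop :=
  smooth f /\
  forall b : N, exists (U : set N) (V : set (set M)),
    [/\ open U, U b, trivIset V id, \bigcup_(A in V) A = f @^-1` U &
        forall A, V A -> open A /\
          exists s : N -> M,
            [/\ smooth_on U s, s @` U = A & forall q, U q -> f (s q) = q]].

(* Transversality of f to the submanifold [range iota], where [iota] is an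
   embedding. *)
Definition transverse (R : realType) (E E' E'' : normedModType R)
    (M : manifold E) (S : manifold E') (N : manifold E'')
    (f : M -> N) (iota : S -> N) : Prop :=
  forall p s, f p = iota s -> forall w : E'', exists u v,
    w = tangent_map f p u + tangent_map iota s v.

Section Forms.
Context {R : realType} {E : normedModType R}.

(* A 2-form at p is evaluated on T_pM, identified with E by [chart_at p]. *)
Definition field2 (M : manifold E) := M -> E -> E -> R.

(* The coordinate expression of omega in a chart. *)
Definition form_in (M : manifold E) (omega : field2 M) (c : chart E M)
    (x u v : E) : R :=
  let D := tangent_map (cinv c : model_manifold E -> M) x in
  omega (cinv c x) (D u) (D v).

Definition is_form2 (M : manifold E) (omega : field2 M) : Prop :=
  [/\ forall p a u u' v,
        omega p (a *: u + u') v = a * omega p u v + omega p u' v,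
      forall p a u v v',
        omega p u (a *: v + v') = a * omega p u v + omega p u v',
      forall p u, omega p u u = 0 &
      forall p u v, Cinfty (ccod (chart_at p))
        (fun x => form_in omega (chart_at p) x u v)].

(* Vacuous on surfaces, kept as part of the notion of symplectic form. *)
Definition closed_form (M : manifold E) (omega : field2 M) : Prop :=
  forall p x, ccod (chart_at p) x -> forall u v w,
    let om a b := fun y => form_in omega (chart_at p) y a b in
    'D_u (om v w) x - 'D_v (om u w) x + 'D_w (om u v) x = 0.

Definition symplectic (M : manifold E) (omega : field2 M) : Prop :=
  [/\ is_form2 omega, closed_form omega &
      forall p u, (forall v, omega p u v = 0) -> u = 0].

End Forms.

Definition pullback (R : realType) (E E' : normedModType R)
    (M : manifold E) (N : manifold E') (f : M -> N) (omega : field2 N) :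
    field2 M :=
  fun p u v => omega (f p) (tangent_map f p u) (tangent_map f p v).

Definition prod_form (R : realType) (E E' : normedModType R)
    (M : manifold E) (N : manifold E') (omega1 : field2 M)
    (omega2 : field2 N) : field2 (prod_manifold M N) :=
  fun p u v =>
    pullback (fst : prod_manifold M N -> M) omega1 p u v -
    pullback (snd : prod_manifold M N -> N) omega2 p u v.

(* The model spaces force dim M = 1/2 dim X. *)
Definition lagrangian_immersion (R : realType) (E : normedModType R)
    (M : manifold E) (X : manifold (E * E)%type) (omega : field2 X)
    (f : M -> X) : Prop :=
  immersion f /\ forall p u v, pullback f omega p u v = 0.

Definition surface (R : realType) := manifold (R * R)%type.

Definition closed_surface (R : realType) (F : surface R) : Prop :=
  compact [set: F] /\ hausdorff_space F.

Definition curve (R : realType) := manifold R.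

Definition immersed_curve (R : realType) (L : curve R) (F : surface R)
    (f : L -> F) : Prop :=
  [/\ hausdorff_space L, @second_countable L & immersion f].

Definition fiber_product (L L' : topologicalType) (X : Type)
    (l : L -> X) (l' : L' -> X) : set (L * L') :=
  [set q | l q.1 = l' q.2].

Section Composition.
Context {R : realType} {F F1 F2 : surface R} {L1 L2 : curve R}.
Variables (g1 : F -> F1) (g2 : F -> F2) (f1 : L1 -> F1) (f2 : L2 -> F2).

(* f1 x g is transverse to Delta_{F1} x F2. *)
Definition composable_left : Prop :=
  transverse (M := prod_manifold L1 F) (S := prod_manifold F1 F2)
    (N := prod_manifold F1 (prod_manifold F1 F2))
    (fun q => (f1 q.1, (g1 q.2, g2 q.2))) (fun q => (q.1, (q.1, q.2))).

(* g x f2 is transverse to F1 x Delta_{F2}. *)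
Definition composable_right : Prop :=
  transverse (M := prod_manifold F L2) (S := prod_manifold F1 F2)
    (N := prod_manifold (prod_manifold F1 F2) F2)
    (fun q => ((g1 q.1, g2 q.1), f2 q.2)) (fun q => ((q.1, q.2), q.2)).

(* L1 o F and F o L2 are the spaces [fiber_product f1 g1] and
   [fiber_product g2 f2] with the maps below.  Only their topology matters for
   intersections and bigons, so their smooth structure is not introduced. *)
Definition comp_left : fiber_product f1 g1 -> F2 := fun q => g2 (\val q).2.

Definition comp_right : fiber_product g2 f2 -> F1 := fun q => g1 (\val q).1.

(* Identification of the intersections with triples (x, y, z). *)
Definition triple_left (p : fiber_product comp_left f2) : L1 * F * L2 :=
  ((\val (\val p).1).1, (\val (\val p).1).2, (\val p).2).

Definition triple_right (p : fiber_product f1 comp_right) : L1 * F * L2 :=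
  ((\val p).1, (\val (\val p).2).1, (\val (\val p).2).2).

End Composition.

Arguments comp_left {R F F1 F2 L1} g1 g2 f1 _.
Arguments comp_right {R F F1 F2 L2} g1 g2 f2 _.
Arguments triple_left {R F F1 F2 L1 L2 g1 g2 f1 f2} p.
Arguments triple_right {R F F1 F2 L1 L2 g1 g2 f1 f2} p.

Definition disc (R : realType) : set (R * R) :=
  [set z | z.1 ^+ 2 + z.2 ^+ 2 <= 1].

Definition upper_arc (R : realType) : set (R * R) :=
  [set z | z.1 ^+ 2 + z.2 ^+ 2 = 1 /\ 0 <= z.2].

Definition lower_arc (R : realType) : set (R * R) :=
  [set z | z.1 ^+ 2 + z.2 ^+ 2 = 1 /\ z.2 <= 0].

Arguments disc : clear implicits.
Arguments upper_arc : clear implicits.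
Arguments lower_arc : clear implicits.

(* The map f sends small neighbourhoods of a onto small neighbourhoods of f a
   in S, i.e. the germ at f a of the image of f near a is that of S. *)
Definition image_germ (T X : topologicalType) (f : T -> X) (a : T)
    (S : set X) : Prop :=
  (\forall t \near a, S (f t)) /\
  (forall N, nbhs a N -> \forall q \near f a, S q -> (f @` N) q).

Section Bigons.
Context {R : realType} {X : surface R} (omega : field2 X).
Context {L L' : topologicalType} (f : L -> X) (f' : L' -> X).

(* u is an immersion, orientation preserving for the orientation of X defined
   by omega, up to and including the boundary except at (1,0) and (-1,0),
   where the image has corners.  Smoothness at a boundary point means that u
   extends smoothly to a neighbourhood of that point in the plane. *)
Definition oriented_immersed_disc (u : disc R -> X) : Prop :=
  continuous u /\
  forall z : disc R, \val z <> (1, 0) -> \val z <> (-1, 0) ->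
    exists (W : set (R * R)) (v : model_manifold (R * R)%type -> X),
      [/\ open W, W (\val z), smooth_on (M := model_manifold (R * R)%type) W v,
          forall z' : disc R, W (\val z') -> v (\val z') = u z' &
          injective (tangent_map v (\val z)) /\
          0 < pullback v omega (\val z) (1, 0) (0, 1)].

(* Near z, the image of u is a quadrant cut out by the branches of L at a and
   of L' at b: in suitable smooth coordinates centred at u z, these branches
   are the two axes and the image of u is the first quadrant (any of the four
   quadrants becomes the first one after reflecting the coordinates). *)
Definition convex_corner (u : disc R -> X) (z : disc R) (a : L) (b : L') :
    Prop :=
  f a = u z /\ f' b = u z /\
  exists c : chart (R * R)%type X,
    [/\ smooth_chart c, cdom c (u z) /\ cto c (u z) = (0, 0),
        image_germ f a [set q | cdom c q /\ (cto c q).2 = 0],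
        image_germ f' b [set q | cdom c q /\ (cto c q).1 = 0] &
        image_germ u z
          [set q | cdom c q /\ 0 <= (cto c q).1 /\ 0 <= (cto c q).2]].

(* u lifts to l over the arc, the lift starting and ending as prescribed. *)
Definition lifts_over (arc : set (R * R)) (K : topologicalType) (l : K -> X)
    (u : disc R -> X) (k k' : K) : Prop :=
  exists a : arc -> K,
    [/\ continuous a,
        forall (s : arc) (z : disc R), \val s = \val z -> l (a s) = u z,
        forall s : arc, \val s = (1, 0) -> a s = k &
        forall s : arc, \val s = (-1, 0) -> a s = k'].

(* The disc u is a bigon connecting x = u(1,0) and y = u(-1,0). *)
Definition is_bigon (u : disc R -> X) (x y : fiber_product f f') : Prop :=
  [/\ oriented_immersed_disc u,
      x <> y,
      lifts_over (upper_arc R) f u (\val x).1 (\val y).1 /\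
      lifts_over (lower_arc R) f' u (\val x).2 (\val y).2,
      forall z : disc R, \val z = (1, 0) ->
        convex_corner u z (\val x).1 (\val x).2 &
      forall z : disc R, \val z = (-1, 0) ->
        convex_corner u z (\val y).1 (\val y).2].

Record bigon := Bigon {
  bigon_map : disc R -> X;
  bigon_src : fiber_product f f';
  bigon_tgt : fiber_product f f';
  bigonP : is_bigon bigon_map bigon_src bigon_tgt }.

(* Bigons are parametrized maps of the disc; they may also be counted up to a
   homeomorphism of the disc fixing (1,0) and (-1,0) and preserving the upper
   half of the boundary. *)
Definition same_bigon (b b' : bigon) : Prop :=
  exists h k : disc R -> disc R,
    [/\ continuous h, continuous k, cancel h k, cancel k h &
     [/\ forall z, \val z = (1, 0) \/ \val z = (-1, 0) -> h z = z,
         forall z, upper_arc R (\val z) -> upper_arc R (\val (h z)),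
         bigon_map b' = bigon_map b \o h,
         bigon_src b' = bigon_src b & bigon_tgt b' = bigon_tgt b]].

End Bigons.

(* Main.v *)
(* A bigon of (L1 o F) x L2 in F2 lifts through the covering g2 to a disc in F,
   because the disc is simply connected; the lift is determined by its value at
   (1,0), read off the corner there.  By uniqueness of lifts, the upper boundary
   arc of the lifted disc lies on L1 o F and its lower one on F o L2, so pushing
   it down by g1 gives a bigon of L1 x (F o L2) in F1.  The construction is
   symmetric in 1 and 2, hence invertible: bigons on either side correspond to
   the same discs in F.  Orientations agree on both sides because F being
   Lagrangian means that g1^* omega1 = g2^* omega2. *)
Require Import Defs.
From HB Require Import structures.
From mathcomp Require Import all_boot all_order all_algebra.
From mathcomp Require Import all_classical all_reals all_analysis.
From mathcomp Require Import lra.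

Set Implicit Arguments.
Unset Strict Implicit.
Unset Printing Implicit Defensive.

Import Order.TTheory GRing.Theory Num.Theory.
Import numFieldNormedType.Exports.

Local Open Scope classical_set_scope.
Local Open Scope ring_scope.

(** * Higher-order differentiability of composites *)

(** The two boundary curves of a bigon reach F for different reasons. Seen from F2, the curve of L1
    o F is already a composite of g2 with a map into F, so its arc is recovered by uniqueness of
    lifts. The curve L2 lives only in F2, and its arc comes from the universal property of F o L2,
    the pullback of L2 along g2. Seen from F1 the roles are exchanged. Hence two mirror-image
    transfer lemmas, whose conditions on a disc in F coincide. Corners are local and a covering is a
    local diffeomorphism; the remaining point is that F o L2 -> L2 is an open map, so that matching
    branches of the two curves have the same germ of image in F2. The disc is contracted along
    segments to (1,0) rather than to its centre, because the value of the lift is known there. Its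
    value at (-1,0) is not prescribed and has to be read off a lifted boundary arc. *)

Section Calculus.
Context {R : realType}.
Implicit Types U V W : normedModType R.

Lemma CnS V W n (A : set V) (f : V -> W) : Cn n.+1 A f -> Cn n A f.
Proof.
elim: n f => [|n IH] f [df Df].
  by move=> x Ax; exact: differentiable_continuous (df x Ax).
by split=> // v; exact: IH (Df v).
Qed.

(** Every clause of [Cn] is a condition at one point at a time, with derivatives taken in the whole
    space, so any set B through x will do. *)
Lemma Cn_local V W n (A : set V) (f : V -> W) :
  (forall x, A x -> exists2 B, B x & Cn n B f) -> Cn n A f.
Proof.
elim: n f => [|n IH] f H /=.
  by move=> x /H[B Bx CB]; exact: (CB x Bx).
split; first by move=> x /H[B Bx [dB _]]; exact: (dB x Bx).
by move=> v; apply: IH => x /H[B Bx [_ DB]]; exists B => //; exact: DB.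
Qed.

Lemma Cn_subset V W n (A B : set V) (f : V -> W) :
  A `<=` B -> Cn n B f -> Cn n A f.
Proof. by move=> AB CB; apply: Cn_local => x /AB Bx; exists B. Qed.

Lemma Cn_add V n (A : set V) (f g : V -> R) : open A ->
  Cn n A f -> Cn n A g -> Cn n A (fun x => f x + g x).
Proof.
move=> oA; elim: n f g => [|n IH] f g /=.
  by move=> cf cg x Ax; apply: cvgD; [exact: cf|exact: cg].
move=> [df Df] [dg Dg]; split.
  by move=> x Ax; apply: differentiableD; [exact: df|exact: dg].
move=> v; apply: (Cn_ext oA _ (IH _ _ (Df v) (Dg v))) => x /set_mem Ax.
rewrite -[fun x => _]/(f + g) deriveD //; apply: diff_derivable.
  exact: df.
exact: dg.
Qed.

Lemma Cn_mul V n (A : set V) (f g : V -> R) : open A ->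
  Cn n A f -> Cn n A g -> Cn n A (fun x => f x * g x).
Proof.
move=> oA; elim: n f g => [|n IH] f g.
  by move=> cf cg x Ax; apply: cvgM; [exact: cf|exact: cg].
move=> Cf Cg; move: (Cf) (Cg) => /= [df Df] [dg Dg]; split.
  by move=> x Ax; apply: differentiableM; [exact: df|exact: dg].
move=> v; have C := Cn_add oA (IH _ _ (CnS Cf) (Dg v)) (IH _ _ (CnS Cg) (Df v)).
apply: (Cn_ext oA _ C) => x /set_mem Ax.
rewrite -[fun x => _]/(f * g) deriveM //; apply: diff_derivable.
  exact: df.
exact: dg.
Qed.

Lemma Cn_pair U V W n (A : set U) (f : U -> V) (g : U -> W) : open A ->
  Cn n A f -> Cn n A g -> Cn n A (fun x => (f x, g x)).
Proof.
move=> oA; elim: n f g => [|n IH] f g /=.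
  by move=> cf cg x Ax; apply: cvg_pair; [exact: cf|exact: cg].
move=> [df Df] [dg Dg]; split.
  by move=> x Ax; apply: differentiable_pair; [exact: df|exact: dg].
move=> v; apply: (Cn_ext oA _ (IH _ _ (Df v) (Dg v))) => x /set_mem Ax.
have [dfx dgx] := (df x Ax, dg x Ax).
by rewrite !deriveE ?diff_pair //; exact: differentiable_pair.
Qed.

Lemma differentiable_fst V W (x : V * W) : differentiable fst x.
Proof.
pose p : {linear (V * W)%type -> V} := (fst : V * W -> V).
by apply: (@linear_differentiable _ _ _ p) => z; exact: cvg_fst.
Qed.

Lemma differentiable_snd V W (x : V * W) : differentiable snd x.
Proof.
pose p : {linear (V * W)%type -> W} := (snd : V * W -> W).
by apply: (@linear_differentiable _ _ _ p) => z; exact: cvg_snd.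
Qed.

Lemma diff_fst V W (x : V * W) : 'd fst x = fst :> (V * W -> V).
Proof.
pose p : {linear (V * W)%type -> V} := (fst : V * W -> V).
by apply: (@diff_lin _ _ _ p) => z; exact: cvg_fst.
Qed.

Lemma diff_snd V W (x : V * W) : 'd snd x = snd :> (V * W -> W).
Proof.
pose p : {linear (V * W)%type -> W} := (snd : V * W -> W).
by apply: (@diff_lin _ _ _ p) => z; exact: cvg_snd.
Qed.

Lemma differentiable_fst_comp U V W (f : U -> V * W) x :
  differentiable f x -> differentiable (fun y => (f y).1) x.
Proof.
by move=> df; apply: differentiable_comp df _; exact: differentiable_fst.
Qed.

Lemma differentiable_snd_comp U V W (f : U -> V * W) x :
  differentiable f x -> differentiable (fun y => (f y).2) x.
Proof.
by move=> df; apply: differentiable_comp df _; exact: differentiable_snd.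
Qed.

Lemma diff_fst_comp U V W (f : U -> V * W) x v :
  differentiable f x -> 'd (fun y => (f y).1) x v = ('d f x v).1.
Proof.
move=> df; rewrite (_ : (fun y => _) = fst \o f) //.
by rewrite (diff_comp df (differentiable_fst _)) /= diff_fst.
Qed.

Lemma diff_snd_comp U V W (f : U -> V * W) x v :
  differentiable f x -> 'd (fun y => (f y).2) x v = ('d f x v).2.
Proof.
move=> df; rewrite (_ : (fun y => _) = snd \o f) //.
by rewrite (diff_comp df (differentiable_snd _)) /= diff_snd.
Qed.

Lemma Cn_fst_comp U V W n (A : set U) (f : U -> V * W) : open A ->
  Cn n A f -> Cn n A (fun x => (f x).1).
Proof.
move=> oA; elim: n f => [|n IH] f /=.
  by move=> cf x Ax; apply: cvg_comp (cf x Ax) _; exact: cvg_fst.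
move=> [df Df]; split=> [x Ax|v].
  exact: differentiable_fst_comp (df x Ax).
apply: (Cn_ext oA _ (IH _ (Df v))) => x /set_mem Ax.
have dfx := df x Ax.
by rewrite !deriveE ?diff_fst_comp //; exact: differentiable_fst_comp.
Qed.

Lemma Cn_snd_comp U V W n (A : set U) (f : U -> V * W) : open A ->
  Cn n A f -> Cn n A (fun x => (f x).2).
Proof.
move=> oA; elim: n f => [|n IH] f /=.
  by move=> cf x Ax; apply: cvg_comp (cf x Ax) _; exact: cvg_snd.
move=> [df Df]; split=> [x Ax|v].
  exact: differentiable_snd_comp (df x Ax).
apply: (Cn_ext oA _ (IH _ (Df v))) => x /set_mem Ax.
have dfx := df x Ax.
by rewrite !deriveE ?diff_snd_comp //; exact: differentiable_snd_comp.
Qed.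

Lemma linear_real2 (L : {linear (R * R)%type -> R}) (w : R * R) :
  L w = w.1 * L (1, 0) + w.2 * L (0, 1).
Proof.
have -> : L w = L (w.1 *: (1, 0) + w.2 *: (0, 1)).
  congr (L _); case: w => a b; congr pair => /=.
    by rewrite scaler0 addr0; exact: (esym (mulr1 a)).
  by rewrite scaler0 add0r; exact: (esym (mulr1 b)).
by rewrite linearD !linearZ.
Qed.

(** The chain rule applies the differential of g to the moving vector ['D_v f x], whereas [Cn]
    speaks of fixed directions. Expanding that vector in the standard basis leaves sums and products
    of functions covered by the induction hypothesis. *)
Lemma Cn_comp_real U n (A : set U) (B : set (R * R)) (f : U -> R * R)
    (g : R * R -> R) : open A -> f @` A `<=` B ->
  Cn n A f -> Cn n B g -> Cn n A (g \o f).
Proof.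
move=> oA fAB; elim: n f g fAB => [|n IH] f g fAB.
  move=> cf cg x Ax; apply: (@cvg_comp _ _ _ f g _ _ _ (cf x Ax)).
  by apply: cg; apply: fAB; exists x.
move=> Cf Cg; move: (Cf) (Cg) => /= [df Df] [dg Dg].
have Bf x : A x -> B (f x) by move=> Ax; apply: fAB; exists x.
split=> [x Ax|v].
  by apply: differentiable_comp; [exact: df|exact/dg/Bf].
have C1 := IH f ('D_(1, 0) g) fAB (CnS Cf) (Dg _).
have C2 := IH f ('D_(0, 1) g) fAB (CnS Cf) (Dg _).
have := Cn_add oA (Cn_mul oA (Cn_fst_comp oA (Df v)) C1)
                  (Cn_mul oA (Cn_snd_comp oA (Df v)) C2).
apply: (Cn_ext oA) => x /set_mem Ax.
have [dfx dgx] := (df x Ax, dg _ (Bf x Ax)).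
rewrite (deriveE v (differentiable_comp dfx dgx)) (diff_comp dfx dgx).
rewrite (deriveE v dfx).
by rewrite /= (deriveE _ dgx) (deriveE _ dgx) [RHS]linear_real2.
Qed.

Lemma Cn_comp U n (A : set U) (B : set (R * R)) (f : U -> R * R)
    (g : R * R -> R * R) : open A -> open B -> f @` A `<=` B ->
  Cn n A f -> Cn n B g -> Cn n A (g \o f).
Proof.
move=> oA oB fAB Cf Cg.
have C1 := Cn_comp_real oA fAB Cf (Cn_fst_comp oB Cg).
have C2 := Cn_comp_real oA fAB Cf (Cn_snd_comp oB Cg).
by apply: (Cn_ext oA _ (Cn_pair oA C1 C2)) => x _ /=; case: (g (f x)).
Qed.

End Calculus.

(** * Tangent maps *)

Lemma open_setI_preimage (T U : topologicalType) (A : set T) (O : set U)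
    (f : T -> U) : open A -> open O ->
  (forall x, A x -> {for x, continuous f}) -> open (A `&` f @^-1` O).
Proof.
move=> oA oO cf; rewrite openE => x [Ax Ofx]; apply: filterI.
  exact: open_nbhs_nbhs.
by apply: (cf x Ax); exact: open_nbhs_nbhs.
Qed.

Section Charts.
Context {R : realType} {E : normedModType R} {T : topologicalType}.
Variable c : chart E T.

Lemma near_cinv (P : set T) p : cdom c p -> (\forall q \near p, P q) ->
  \forall x \near cto c p, P (cinv c x).
Proof.
move=> cp nP; have := cinv_cont (cto_cod cp).
rewrite /prop_for /continuous_at cinvK //; exact.
Qed.

Lemma near_cdom p : cdom c p -> \forall q \near p, cdom c q.
Proof. by move=> cp; exact: open_nbhs_nbhs (conj (cdom_open c) cp). Qed.

Lemma near_ccod p : cdom c p -> \forall x \near cto c p, ccod c x.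
Proof.
by move=> cp; apply: open_nbhs_nbhs (conj (ccod_open c) _); exact: cto_cod.
Qed.

End Charts.

Section Derivatives.
Context {R : realType}.

Lemma near_eq_diff (V W : normedModType R) (f g : V -> W) (x : V) :
  (\forall y \near x, f y = g y) -> differentiable f x ->
  'd f x = 'd g x :> (V -> W).
Proof.
move=> fg df; apply/funext => v; have dg := near_eq_differentiable fg df.
by rewrite -!deriveE //; apply: near_eq_derive.
Qed.

Lemma diff_idE (V : normedModType R) (x : V) : 'd id x = id :> (V -> V).
Proof. by apply/funext => v; rewrite -deriveE // derive_id. Qed.

End Derivatives.

Section TangentMaps.
Context {R : realType}.

Definition coord (E E' : normedModType R) (M : manifold E) (N : manifold E')
    (f : M -> N) (p : M) : E -> E' :=
  cto (chart_at (f p)) \o f \o cinv (chart_at p).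

(** Continuity is included because [cto] is meaningful only on the chart domain: without it,
    [coord f p] would not control f where f leaves the chart at f p. *)
Definition mdiff (E E' : normedModType R) (M : manifold E) (N : manifold E')
    (f : M -> N) (p : M) : Prop :=
  {for p, continuous f} /\ differentiable (coord f p) (cto (chart_at p) p).

Lemma coord_cto (E E' : normedModType R) (M : manifold E) (N : manifold E')
    (f : M -> N) p :
  coord f p (cto (chart_at p) p) = cto (chart_at (f p)) (f p).
Proof. by rewrite /coord /= cinvK //; exact: chart_at_dom. Qed.

Lemma smooth_on_mdiff (E E' : normedModType R) (M : manifold E)
    (N : manifold E') (A : set M) (f : M -> N) p :
  smooth_on A f -> A p -> mdiff f p.
Proof.
move=> [cf Cf] Ap; split; first exact: cf.
have [df _] := Cf p (f p) 1%N; apply: df; split.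
  exact/cto_cod/chart_at_dom.
rewrite /= cinvK; last exact: chart_at_dom.
by split=> //; exact: chart_at_dom.
Qed.

Lemma tangent_near_eq (E E' : normedModType R) (M : manifold E)
    (N : manifold E') (f g : M -> N) p :
  (\forall q \near p, f q = g q) -> mdiff f p ->
  mdiff g p /\ tangent_map f p = tangent_map g p.
Proof.
move=> fg [cf df]; have fgp := nbhs_singleton fg.
have E1 : \forall x \near cto (chart_at p) p, coord f p x = coord g p x.
  have := near_cinv (chart_at_dom p) fg.
  by apply: filterS => x; rewrite /coord /= -fgp => ->.
split; last exact: near_eq_diff E1 df.
split; last exact: near_eq_differentiable E1 df.
rewrite /prop_for /continuous_at -fgp; apply: cvg_trans cf.
by apply: near_eq_cvg; apply: filterS fg => x ->.
Qed.

Lemma tangent_comp (E E' E'' : normedModType R) (M : manifold E)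
    (N : manifold E') (P : manifold E'') (f : M -> N) (g : N -> P) p :
  mdiff f p -> mdiff g (f p) ->
  mdiff (g \o f) p /\
  forall u, tangent_map (g \o f) p u = tangent_map g (f p) (tangent_map f p u).
Proof.
move=> [cf df] [cg dg].
have dg' : differentiable (coord g (f p)) (coord f p (cto (chart_at p) p)).
  by rewrite coord_cto.
(* The chart at f p cancels only where f stays inside it, hence only near p. *)
have E1 : \forall x \near cto (chart_at p) p,
    (coord g (f p) \o coord f p) x = coord (g \o f) p x.
  have : \forall q \near p, cdom (chart_at (f p)) (f q).
    exact: cf (near_cdom (chart_at_dom (f p))).
  move=> /(near_cinv (chart_at_dom p)); apply: filterS => x dx.
  by rewrite /coord /= cinvK.
have dgf := differentiable_comp df dg'.
split.
  split; last exact: near_eq_differentiable E1 dgf.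
  exact: (@cvg_comp _ _ _ f g _ _ _ cf cg).
move=> u; rewrite /tangent_map -[_ \o _ \o _]/(coord (g \o f) p).
by rewrite -(near_eq_diff E1 dgf) (diff_comp df dg') /= coord_cto.
Qed.

Lemma mdiff_id (E : normedModType R) (M : manifold E) (p : M) :
  mdiff id p /\ forall u, tangent_map id p u = u.
Proof.
have E1 : \forall x \near cto (chart_at p) p, id x = coord id p x.
  apply: filterS (near_ccod (chart_at_dom p)) => x cx.
  by rewrite /coord /= ctoK.
have did : differentiable (@id E) (cto (chart_at p) p) by [].
split.
  split; [exact: cvg_id|exact: near_eq_differentiable E1 did].
move=> u; rewrite /tangent_map -[_ \o _ \o _]/(coord id p).
by rewrite -(near_eq_diff E1 did) diff_idE.
Qed.

Section Products.
Context {E E' E'' : normedModType R}.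
Context {M : manifold E} {N : manifold E'} {P : manifold E''}.

Lemma tangent_pair (f : M -> N) (g : M -> P) p : mdiff f p -> mdiff g p ->
  mdiff (N := prod_manifold N P) (fun q => (f q, g q)) p /\
  forall u, tangent_map (N := prod_manifold N P) (fun q => (f q, g q)) p u =
    (tangent_map f p u, tangent_map g p u).
Proof.
move=> [cf df] [cg dg]; split; first split.
- exact: cvg_pair.
- exact: differentiable_pair.
- by move=> u; rewrite /tangent_map [LHS](congr1 (@^~ u) (diff_pair df dg)).
Qed.

Lemma tangent_fst (p : prod_manifold M N) :
  mdiff (fst : prod_manifold M N -> M) p /\
  forall u, tangent_map (fst : prod_manifold M N -> M) p u = u.1.
Proof.
case: p => a b.
have E1 : \forall x \near (cto (chart_at a) a, cto (chart_at b) b),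
    x.1 = coord (fst : prod_manifold M N -> M) (a, b) x.
  have := @near_ccod _ _ _ (prod_chart (chart_at a) (chart_at b)) (a, b)
    (conj (chart_at_dom a) (chart_at_dom b)).
  by apply: filterS => x [/= c1 c2]; rewrite /coord /= ctoK.
have d1 := differentiable_fst (cto (chart_at a) a, cto (chart_at b) b).
split.
  split; [exact: cvg_fst|exact: near_eq_differentiable E1 d1].
move=> u; rewrite /tangent_map.
rewrite -[_ \o _ \o _]/(coord (fst : prod_manifold M N -> M) (a, b)).
by rewrite -(near_eq_diff E1 d1) diff_fst.
Qed.

Lemma tangent_snd (p : prod_manifold M N) :
  mdiff (snd : prod_manifold M N -> N) p /\
  forall u, tangent_map (snd : prod_manifold M N -> N) p u = u.2.
Proof.
case: p => a b.
have E1 : \forall x \near (cto (chart_at a) a, cto (chart_at b) b),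
    x.2 = coord (snd : prod_manifold M N -> N) (a, b) x.
  have := @near_ccod _ _ _ (prod_chart (chart_at a) (chart_at b)) (a, b)
    (conj (chart_at_dom a) (chart_at_dom b)).
  by apply: filterS => x [/= c1 c2]; rewrite /coord /= ctoK.
have d1 := differentiable_snd (cto (chart_at a) a, cto (chart_at b) b).
split.
  split; [exact: cvg_snd|exact: near_eq_differentiable E1 d1].
move=> u; rewrite /tangent_map.
rewrite -[_ \o _ \o _]/(coord (snd : prod_manifold M N -> N) (a, b)).
by rewrite -(near_eq_diff E1 d1) diff_snd.
Qed.

End Products.

Lemma pullback_comp (E E' E'' : normedModType R) (M : manifold E)
    (N : manifold E') (P : manifold E'') (f : M -> N) (g : N -> P)
    (omega : field2 P) p u v :
  mdiff f p -> mdiff g (f p) ->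
  pullback (g \o f) omega p u v = pullback f (pullback g omega) p u v.
Proof.
by move=> mf mg; have [_ E1] := tangent_comp mf mg; rewrite /pullback !E1.
Qed.

End TangentMaps.

(** * Local diffeomorphisms and germs of images *)

Section LocalDiffeos.
Context {R : realType}.
Implicit Types M N P : surface R.

Local Notation plane := (model_manifold (R * R)%type).

(** The middle chart has to be taken at the image of each point, so the composite of coordinate
    expressions is split point by point, through [Cn_local]. *)
Lemma smooth_on_comp M N P (A : set M) (B : set N) (f : M -> N) (g : N -> P) :
  open A -> open B -> f @` A `<=` B -> smooth_on A f -> smooth_on B g ->
  smooth_on A (g \o f).
Proof.
move=> oA oB fAB [cf Cf] [cg Cg].
have Bf p : A p -> B (f p) by move=> Ap; apply: fAB; exists p.
have cgf p : A p -> {for p, continuous (g \o f)}.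
  by move=> Ap; apply: (@cvg_comp _ _ _ f g _ _ _ (cf p Ap)); exact/cg/Bf.
split=> // p q c d n; apply: Cn_local => x [cx [Ax dx]].
pose e := chart_at (f (cinv c x)).
pose O := B `&` g @^-1` cdom d.
have oO : open O by apply: open_setI_preimage => //; exact: cdom_open.
pose S := ccod c `&` cinv c @^-1` (A `&` f @^-1` (cdom e `&` O)).
have oS : open S.
  apply: open_setI_preimage; [exact: ccod_open| |exact: cinv_cont].
  by apply: open_setI_preimage => //; apply: openI => //; exact: cdom_open.
have oS' : open (ccod e `&` cinv e @^-1` O).
  by apply: open_setI_preimage => //; [exact: ccod_open|exact: cinv_cont].
exists S.
  by split=> //; split=> //; split; [exact: chart_at_dom|split=> //; exact: Bf].
have C1 : Cn n S (cto e \o f \o cinv c).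
  by apply: Cn_subset (Cf p _ n) => y [cy [Ay [ey _]]]; split.
have C2 := Cg (f (cinv c x)) q n.
have fS : (cto e \o f \o cinv c) @` S `<=` ccod e `&` cinv e @^-1` O.
  move=> _ [y [cy [Ay [ey Oy]]] <-]; split; first exact: cto_cod.
  by rewrite /= cinvK.
apply: (Cn_ext oS _ (Cn_comp oS oS' fS C1 C2)) => y /set_mem [cy [Ay [ey _]]].
by rewrite /= cinvK.
Qed.

Lemma smooth_on_subset M N (A B : set M) (f : M -> N) :
  A `<=` B -> smooth_on B f -> smooth_on A f.
Proof.
move=> AB [cf Cf]; split=> [p /AB|p q c d n]; first exact: cf.
apply: Cn_subset (Cf p q n) => x [cx [Ax dx]].
by split=> //; split=> //; exact: AB.
Qed.

(** Reduces membership in the maximal atlas to smoothness of maps to and from the plane, so that a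
    transported chart is handled by [smooth_on_comp]. *)
Lemma smooth_chartP M (c : chart (R * R)%type M) :
  smooth_chart c <->
  smooth_on (N := plane) (cdom c) (cto c) /\
  smooth_on (M := plane) (ccod c) (cinv c).
Proof.
split=> [sc|[[_ s1] [_ s2]] p].
  split; split; [exact: cto_cont| |exact: cinv_cont|] => p q d e n.
    by apply: Cn_subset ((sc p).2 n) => x [dx [cx _]]; split.
  by apply: Cn_subset ((sc q).1 n) => x [_ [cx ex]]; split.
split=> n.
  (* The point 0 is arbitrary: every preferred chart of the plane is the identity. *)
  apply: Cn_subset (s2 0 p n) => x [cx px].
  by split.
by apply: Cn_subset (s1 p 0 n) => x [cx px]; split.
Qed.

Definition local_diffeo M N (A : set M) (B : set N) (phi : M -> N)
    (psi : N -> M) : Prop :=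
  [/\ open A, open B, smooth_on A phi & smooth_on B psi] /\
  (forall p, A p -> B (phi p) /\ psi (phi p) = p) /\
  (forall q, B q -> A (psi q) /\ phi (psi q) = q).

Lemma local_diffeo_sym M N (A : set M) (B : set N) phi psi :
  local_diffeo A B phi psi -> local_diffeo B A psi phi.
Proof. by move=> [[? ? ? ?] [? ?]]. Qed.

Lemma tangent_local_diffeo M N (A : set M) (B : set N) phi psi p u :
  local_diffeo A B phi psi -> A p ->
  tangent_map psi (phi p) (tangent_map phi p u) = u.
Proof.
move=> [[oA oB s1 s2] [h1 h2]] Ap; have [Bp K] := h1 p Ap.
have m1 := smooth_on_mdiff s1 Ap.
have m2 := smooth_on_mdiff s2 Bp.
have [m3 <-] := tangent_comp m1 m2.
have [mi Ti] := mdiff_id p.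
have near_id : \forall q \near p, id q = (psi \o phi) q.
  have := open_nbhs_nbhs (conj oA Ap).
  by apply: filterS => q /h1[].
by have [_ <-] := tangent_near_eq near_id mi.
Qed.

Section TransportChart.
Context {M N : surface R} {A : set M} {B : set N} {phi : M -> N} {psi : N -> M}.
Variables (h : local_diffeo A B phi psi) (c : chart (R * R)%type M).

(** Carries the chart that exhibits a convex corner across a local diffeomorphism. Its domain is cut
    down because c may extend beyond A. *)
Definition transport_chart : chart (R * R)%type N.
Proof.
refine (@Chart R (R * R)%type N (B `&` psi @^-1` cdom c)
  (ccod c `&` cinv c @^-1` A) (cto c \o psi) (phi \o cinv c) _ _ _ _ _ _ _ _);
  case: h => [[oA oB [c1 _] [c2 _]] [h1 h2]].
- by apply: open_setI_preimage => //; exact: cdom_open.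
- by apply: open_setI_preimage => //; [exact: ccod_open|exact: cinv_cont].
- move=> q [/h2[Aq _] cq]; split; first exact: cto_cod.
  by rewrite /= cinvK.
- move=> x [cx /h1[Bx K]]; split=> //=; rewrite K; exact: cinv_dom.
- by move=> q [/h2[Aq K] cq]; rewrite /= cinvK.
- by move=> x [cx /h1[Bx K]]; rewrite /= K ctoK.
- move=> q [Bq cq]; apply: (@cvg_comp _ _ _ psi (cto c) _ _ _ (c2 q Bq)).
  exact: cto_cont.
- move=> x [cx Ax]; apply: (@cvg_comp _ _ _ (cinv c) phi _ _ _ (cinv_cont cx)).
  exact: c1.
Defined.

Lemma transport_chart_smooth : smooth_chart c -> smooth_chart transport_chart.
Proof.
move=> /smooth_chartP[s1 s2]; apply/smooth_chartP.
have o1 := cdom_open transport_chart; have o2 := ccod_open transport_chart.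
have [[oA oB sphi spsi] [h1 h2]] := h.
split.
  apply: (smooth_on_comp o1 (cdom_open c) _ _ s1).
    by move=> _ [q [_ cq] <-].
  by apply: smooth_on_subset spsi => q [].
apply: (@smooth_on_comp plane _ _ _ _ _ _ o2 oA _ _ sphi).
  by move=> _ [x [_ Ax] <-].
by apply: smooth_on_subset s2 => x [].
Qed.

End TransportChart.

End LocalDiffeos.

Section Germs.

Lemma image_germ_near_eq (T X : topologicalType) (f g : T -> X) a (S : set X) :
  (\forall t \near a, f t = g t) -> image_germ f a S -> image_germ g a S.
Proof.
move=> fg [h1 h2]; split.
  by apply: filterS2 fg h1 => t ->.
move=> V nV; rewrite -(nbhs_singleton fg).
apply: filterS (h2 _ (filterI nV fg)) => q H /H[t [Vt ft] <-].
by exists t => //; rewrite ft.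
Qed.

Lemma image_germ_comp (T X Y : topologicalType) (f : T -> X) (phi : X -> Y)
    (psi : Y -> X) a (S : set X) (S' : set Y) :
  {for a, continuous f} -> {for f a, continuous phi} ->
  {for phi (f a), continuous psi} ->
  (\forall p \near f a, psi (phi p) = p) ->
  (\forall q \near phi (f a), phi (psi q) = q) ->
  (\forall q \near phi (f a), S' q <-> S (psi q)) ->
  image_germ f a S -> image_germ (phi \o f) a S'.
Proof.
move=> cf cphi cpsi K1 K2 SS' [h1 h2]; split.
  have h3 : \forall t \near a, psi (phi (f t)) = f t by exact: cf K1.
  have h4 : \forall t \near a, S' (phi (f t)) <-> S (psi (phi (f t))).
    exact: (@cvg_comp _ _ _ f phi _ _ _ cf cphi _ SS').
  near=> t.
  have E1 : psi (phi (f t)) = f t by near: t.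
  have E2 : S' (phi (f t)) <-> S (psi (phi (f t))) by near: t.
  by apply/E2; rewrite E1; near: t.
move=> V nV; have h3 := h2 _ nV.
rewrite -(nbhs_singleton K1) in h3.
have h4 := cpsi _ h3.
near=> q => S'q.
have E1 : S' q <-> S (psi q) by near: q.
have E2 : phi (psi q) = q by near: q.
have E3 : S (psi q) -> (f @` V) (psi q) by near: q.
have [t Vt ft] := E3 (E1.1 S'q).
by exists t => //=; rewrite ft.
Unshelve. all: by end_near. Qed.

(** If h is open at a, the images under h of the neighbourhoods of a are again neighbourhoods of h
    a, so f near h a and [f \o h] near a trace the same sets. This is meant for the projection of a
    pullback along a covering. *)
Lemma image_germ_open (T U X : topologicalType) (h : T -> U) (f : U -> X) a
    (S : set X) :
  {for a, continuous h} -> (forall V, nbhs a V -> nbhs (h a) (h @` V)) ->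
  image_germ (f \o h) a S <-> image_germ f (h a) S.
Proof.
move=> ch oh; split=> -[h1 h2]; split.
- by apply: filterS (oh _ h1) => _ [t St <-].
- move=> V /ch/h2; apply: filterS => q H /H[t Vt <-].
  by exists (h t).
- exact: ch h1.
- by move=> V /oh/h2; apply: filterS => q H /H[_ [t Vt <-] <-]; exists t.
Qed.

End Germs.

(** * Lifting through coverings *)

(** The trace of P on A is open and closed in A. All continuation arguments below are instances of
    this. *)
Lemma connected_locally_constant (T : topologicalType) (A : set T)
    (P : T -> Prop) : connected A ->
  (forall x, A x -> \forall y \near x, A y -> (P y <-> P x)) ->
  forall x y, A x -> A y -> P x -> P y.
Proof.
move=> cA lc x y Ax Ay Px.
suff E : A `&` P = A by have : (A `&` P) y by [rewrite E]; case.
apply: cA; first by exists x.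
  (* The implication imposes nothing off A, so local constancy along A yields neighbourhoods in the
     whole space. *)
  exists (interior [set z | A z -> P z]); first exact: open_interior.
  apply/seteqP; split=> z [Az].
    move=> Pz; split=> //; have := lc z Az; apply: filterS => w H Aw.
    exact/H.
  by move=> /interior_subset /(_ Az).
exists (~` interior [set z | A z -> ~ P z]).
  by apply: open_closedC; exact: open_interior.
apply/seteqP; split=> z [Az].
  by move=> Pz; split=> // /interior_subset /(_ Az).
move=> nPz; split=> //; apply: contrapT => nPz'; apply: nPz.
have := lc z Az; apply: filterS => w H Aw Pw; apply: nPz'.
exact/H.
Qed.

Lemma near_connected (R : realType) (x : R) (N : set R) : nbhs x N ->
  exists2 B, connected B & [/\ open B, B x & B `<=` N].
Proof.
move=> /nbhs_ballP[e /= e0 eN]; exists (ball x e); last first.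
  by split=> //; [exact: ball_open|exact: ballxx].
by rewrite ball_itv; apply/connected_intervalP; exact: interval_is_interval.
Qed.

Lemma continuous_glue (R : realType) (T : topologicalType) (f g : R -> T) t :
  continuous f -> continuous g -> f t = g t ->
  continuous (fun s => if s <= t then f s else g s).
Proof.
move=> cf cg fg.
set h := (fun s => _).
have H : {within [set x | x <= t] `|` [set x | t <= x], continuous h}.
  apply: withinU_continuous; [exact: closed_le|exact: closed_ge| |].
    apply: (@subspace_eq_continuous _ _ _ f); last exact: continuous_subspaceT.
    by move=> x /set_mem /= xt; have : h x = f x by rewrite /h xt.
  apply: (@subspace_eq_continuous _ _ _ g); last exact: continuous_subspaceT.
  move=> x /set_mem /= tx; suff : h x = g x by [].
  rewrite /h; case: ifPn => // xt.
  by have -> : x = t by apply/eqP; rewrite eq_le xt.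
apply/continuous_subspace_setT.
rewrite (_ : setT = [set x | x <= t] `|` [set x | t <= x]) //.
by apply/seteqP; split=> // x _; case: (leP x t) => [|/ltW]; [left|right].
Qed.

Lemma continuous_minr (R : realType) (c : R) :
  continuous (fun s => Num.min s c).
Proof. by move=> x; apply: continuous_min; [exact: cvg_id|exact: cvg_cst]. Qed.

Lemma continuous_maxl (R : realType) (c : R) :
  continuous (fun s => Num.max c s).
Proof. by move=> x; apply: continuous_max; [exact: cvg_cst|exact: cvg_id]. Qed.

Lemma continuous_pair (T U V : topologicalType) (f : T -> U) (g : T -> V) x :
  {for x, continuous f} -> {for x, continuous g} ->
  {for x, continuous (fun y => (f y, g y))}.
Proof. exact: cvg_pair. Qed.

Lemma continuous_partial_r (T U V : topologicalType) (h : T * U -> V) z :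
  continuous h -> continuous (fun t => h (z, t)).
Proof.
move=> ch t; have c : {for t, continuous (fun t => (z, t))}.
  by apply: continuous_pair; [exact: cvg_cst|exact: cvg_id].
exact: (@continuous_comp _ _ _ (fun t => (z, t)) h t c (ch (z, t))).
Qed.

Lemma continuous_partial_l (T U V : topologicalType) (h : T * U -> V) t z :
  {for (z, t), continuous h} -> {for z, continuous (fun z => h (z, t))}.
Proof.
move=> ch; have c : {for z, continuous (fun z => (z, t))}.
  by apply: continuous_pair; [exact: cvg_id|exact: cvg_cst].
exact: (@continuous_comp _ _ _ (fun z => (z, t)) h z c ch).
Qed.

Section Lifting.
Context {R : realType} {F B : topologicalType}.

(* [sigma y] is the section of the sheet through y. *)
Definition trivial_over (g : F -> B) (U : set B) (sigma : F -> B -> F) : Prop :=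
  forall y, U (g y) ->
    [/\ forall q, U q -> {for q, continuous (sigma y)} /\ g (sigma y q) = q,
        sigma y (g y) = y &
        \forall y' \near y, sigma y' = sigma y].

(** A sheet is represented by its section, so that staying on one sheet becomes an equation between
    functions [sigma y], to which local constancy arguments apply directly. *)
Definition top_covering (g : F -> B) : Prop :=
  continuous g /\ forall b : B, exists2 U, nbhs b U &
    exists sigma, trivial_over g U sigma.

Variable g : F -> B.
Hypothesis covg : top_covering g.
Let cg : continuous g := covg.1.

Lemma sheet_constant (T : topologicalType) (A : set T) (l : T -> F) U sigma :
  trivial_over g U sigma -> connected A -> continuous l ->
  (forall x, A x -> U (g (l x))) ->
  forall x y, A x -> A y -> sigma (l x) = sigma (l y).
Proof.
move=> tr cA cl AU x y Ax Ay.
apply: (connected_locally_constant cA (P := fun z => sigma (l x) = sigma (l z))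
  _ Ax Ay) => // z Az.
have [_ _ H] := tr _ (AU z Az).
have {}H : \forall w \near z, sigma (l w) = sigma (l z) by exact: cl H.
by apply: filterS H => w -> _.
Qed.

(** Near t each lift stays on the sheet it occupies at t. Agreement at s and agreement at t
    therefore both mean that the two lifts use the same section. S is arbitrary and the path c joins
    the two points compared. *)
Lemma lift_unique (S : topologicalType) (l1 l2 : S -> F) (c : R -> S) a b :
  continuous l1 -> continuous l2 -> (forall s, g (l1 s) = g (l2 s)) ->
  continuous c -> l1 (c a) = l2 (c a) -> l1 (c b) = l2 (c b).
Proof.
move=> c1 c2 E cc; have cT : connected [set: R].
  by apply/connected_intervalP.
apply: (connected_locally_constant cT (P := fun t => l1 (c t) = l2 (c t)) _
  (x := a) (y := b)) => // t _.
have cc1 : continuous (l1 \o c).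
  by move=> x; apply: continuous_comp; [exact: cc|exact: c1].
have cc2 : continuous (l2 \o c).
  by move=> x; apply: continuous_comp; [exact: cc|exact: c2].
have [U nU [sigma tr]] := covg.2 (g (l1 (c t))).
have U1 := nbhs_singleton nU.
have U2 : U (g (l2 (c t))) by rewrite -E.
have [h1 k1 n1] := tr _ U1.
have [h2 k2 n2] := tr _ U2.
have {}n1 : \forall s \near t, sigma (l1 (c s)) = sigma (l1 (c t)).
  exact: cc1 n1.
have {}n2 : \forall s \near t, sigma (l2 (c s)) = sigma (l2 (c t)).
  exact: cc2 n2.
have n3 : \forall s \near t, U (g (l1 (c s))).
  exact: (cc1 t _ (cg nU)).
near=> s => _.
have e1 : sigma (l1 (c s)) = sigma (l1 (c t)) by near: s.
have e2 : sigma (l2 (c s)) = sigma (l2 (c t)) by near: s.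
have V1 : U (g (l1 (c s))) by near: s.
have V2 : U (g (l2 (c s))) by rewrite -E.
have [_ j1 _] := tr _ V1; have [_ j2 _] := tr _ V2.
split=> e.
  by rewrite -k1 -k2 -e1 -e2 e E.
by rewrite -j1 -j2 e1 e2 e E.
Unshelve. all: by end_near. Qed.

(* The path is stopped at time t, so that lifts are total functions on R; the
   set of the t for which a lift exists is open and closed. *)
Lemma path_lift (p : R -> B) (y : F) : continuous p ->
  (forall s, s <= 0 -> p s = p 0) -> g y = p 0 -> forall t, 0 <= t ->
  exists l : R -> F, [/\ continuous l, l 0 = y &
    forall s, g (l s) = p (Num.min s t)].
Proof.
move=> cp p0 gy t t0.
pose P t := 0 <= t -> exists l : R -> F, [/\ continuous l, l 0 = y &
  forall s, g (l s) = p (Num.min s t)].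
have cT : connected [set: R] by apply/connected_intervalP.
have P0 : P 0.
  exists (fun=> y); split=> // [|s]; first by move=> x; exact: cvg_cst.
  by rewrite gy p0 // ge_min lexx orbT.
suff H a : \forall b \near a, setT b -> (P b <-> P a).
  exact: (connected_locally_constant cT (fun x _ => H x) (x := 0) (y := t)).
have [U nU [sigma tr]] := covg.2 (p a).
have [N cN [oN Na NU]] := near_connected (cp _ _ nU).
have nN := open_nbhs_nbhs (conj oN Na).
have itvN : is_interval N by apply/connected_intervalP.
suff step b c : N b -> N c -> P b -> P c.
  by apply: filterS nN => b Nb _; split; exact: step.
(* For b < 0 the hypothesis [P b] is vacuous; but then 0 lies between b and c, hence in N, and [P0]
   takes its place. *)
move=> Nb Nc; wlog b0 : b Nb / 0 <= b.
  move=> W Pb c0; case: (leP 0 b) => [b0|b0]; first exact: (W b).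
  by apply: (W 0) => //; apply: (itvN b c) => //; rewrite (ltW b0).
move=> /(_ b0)[l [cl l0 gl]] c0.
have [cb|bc] := leP c b.
  exists (fun s => l (Num.min s c)); split.
  - move=> x; apply: (@continuous_comp _ _ _ (fun s => Num.min s c) l).
      exact: continuous_minr.
    exact: cl.
  - by rewrite min_l.
  - by move=> s; rewrite gl -minA (min_l cb).
(* Clamping to [b, c] keeps [p (k s)] in U for every real s, so the new piece is continuous on all
   of R and is stopped at c. *)
pose k s := Num.max b (Num.min s c).
have ck : continuous k.
  move=> x; apply: (@continuous_comp _ _ _ (fun s => Num.min s c) (Num.max b)).
    exact: continuous_minr.
  exact: continuous_maxl.
have kN s : N (k s).
  apply: (itvN b c) => //; rewrite le_max lexx /= ge_max (ltW bc) /=.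
  by rewrite ge_min lexx orbT.
have gb : g (l b) = p b by rewrite gl minxx.
have Ub : U (g (l b)) by rewrite gb; exact: NU.
have [h1 h2 _] := tr _ Ub.
exists (fun s => if s <= b then l s else sigma (l b) (p (k s))); split.
- apply: continuous_glue => //; last by rewrite /k min_l ?maxxx -?gb // ltW.
  move=> x; apply: (@continuous_comp _ _ _ (p \o k) (sigma (l b))).
    by apply: continuous_comp; [exact: ck|exact: cp].
  by have [] := h1 (p (k x)) (NU _ (kN x)).
- by rewrite b0.
- move=> s; case: (leP s b) => sb.
    by rewrite gl min_l // min_l // (le_trans sb) // ltW.
  have [_ ->] := h1 (p (k s)) (NU _ (kN s)); rewrite /k max_r //.
  by rewrite le_min !ltW.
Qed.

(* Each path h (z, -) is lifted separately; for given z0, the set of the t at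
   which the lifts depend continuously on z at z0 is open and closed. *)
Lemma homotopy_lift (Z : topologicalType) (h : Z * R -> B) (l0 : Z -> F) :
  continuous h -> (forall z t, t <= 0 -> h (z, t) = h (z, 0)) ->
  (forall z t, 1 <= t -> h (z, t) = h (z, 1)) ->
  continuous l0 -> (forall z, g (l0 z) = h (z, 0)) ->
  exists H : Z * R -> F,
    [/\ continuous H, forall z, H (z, 0) = l0 z & forall x, g (H x) = h x].
Proof.
move=> ch h0 h1 cl0 gl0.
have chz z : continuous (fun t => h (z, t)) by exact: continuous_partial_r.
have /choice[l lP] z : exists l : R -> F, [/\ continuous l, l 0 = l0 z &
    forall s, g (l s) = h (z, s)].
  have [l [cl e1 e2]] := path_lift (chz z) (h0 z) (gl0 z) ler01.
  exists l; split=> // s; rewrite e2; case: (leP s 1) => // /ltW s1.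
  by rewrite (h1 z s).
exists (fun x => l x.1 x.2); split; last 2 first.
- by move=> z /=; have [_ ->] := lP z.
- by move=> [z t] /=; have [_ _ ->] := lP z.
have cT : connected [set: R] by apply/connected_intervalP.
move=> [z0 t1].
pose P b := {for z0, continuous (fun z => l z b)}.
have local (a : R) : exists2 N, nbhs a N &
    forall b, N b -> P b -> forall c, N c ->
    {for (z0, c), continuous (fun x : Z * R => l x.1 x.2)}.
  have [U nU [sigma tr]] := covg.2 (h (z0, a)).
  have [[M N'] /= [nM nN'] MNU] := ch _ _ nU.
  have [N cN [oN Na NN']] := near_connected nN'.
  exists N; first exact: open_nbhs_nbhs.
  move=> b Nb Pb c Nc.
  have UMN z d : M z -> N d -> U (h (z, d)).
    by move=> Mz Nd; apply: (MNU (z, d)); split=> //; exact: NN'.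
  have Mz0 := nbhs_singleton nM.
  have gl z d : g (l z d) = h (z, d) by have [_ _ ->] := lP z.
  have Ub : U (g (l z0 b)) by rewrite gl; exact: UMN.
  have [s1 s2 s3] := tr _ Ub.
  have {}s3 : \forall z \near z0, sigma (l z b) = sigma (l z0 b).
    exact: Pb s3.
  (* For z near z0 the lifts l z and l z0 are on the same sheet at time b, by continuity there, and
     each stays on its sheet over the connected set N. So near (z0, c) the lift is one fixed section
     composed with h. *)
  have E : \forall x \near (z0, c), sigma (l z0 b) (h x) = l x.1 x.2.
    exists ([set z | M z /\ sigma (l z b) = sigma (l z0 b)], N).
      by split; [exact: filterI|exact: open_nbhs_nbhs].
    move=> [z d] /= [[Mz sz] Nd].
    have [cl _ _] := lP z.
    rewrite -sz (sheet_constant tr cN cl _ Nb Nd); last first.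
      by move=> e Ne; rewrite gl; exact: UMN.
    have Ud : U (g (l z d)) by rewrite gl; exact: UMN.
    by have [_ + _] := tr _ Ud; rewrite gl.
  rewrite /prop_for /continuous_at -(nbhs_singleton E).
  apply: cvg_trans (near_eq_cvg E) _.
  apply: (@cvg_comp _ _ _ h (sigma (l z0 b)) _ _ _ (ch _)).
  by have [] := s1 _ (UMN _ _ Mz0 Nc).
have restr c : {for (z0, c), continuous (fun x : Z * R => l x.1 x.2)} -> P c.
  by move=> /continuous_partial_l.
have Pt : P t1.
  apply: (connected_locally_constant cT (P := P) _ (x := 0)) => // [a _|].
    have [N nN H] := local a; apply: filterS (nN) => b Nb _.
    have Na := nbhs_singleton nN.
    by split=> P'; apply: restr; [exact: (H b)|exact: (H a)].
  rewrite /P (_ : (fun z => _) = l0); first exact: cl0.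
  by apply/funext => z; have [_ ->] := lP z.
have [N nN H] := local t1; have Nt := nbhs_singleton nN.
exact: (H t1).
Qed.

End Lifting.

(** * Immersed discs and convex corners under coverings *)

Lemma nbhs_set_typeP (X : topologicalType) (A : set X) (z : A) (V : set A) :
  nbhs z V -> exists O : set X, [/\ open O, O (\val z) &
    forall z' : A, O (\val z') -> V z'].
Proof.
move=> [_ [] [] O oO <- Oz OV]; by exists O; split.
Qed.

Section Coverings.
Context {R : realType}.
Local Notation plane := (model_manifold (R * R)%type).

Lemma covering_top (E E' : normedModType R) (M : manifold E) (N : manifold E')
    (g : M -> N) : covering_map g -> top_covering g.
Proof.
move=> [[cg _] ev]; split=> [x|b]; first exact: cg.
have [U [V [oU Ub tV VU sec]]] := ev b; exists U; first exact: open_nbhs_nbhs.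
(* A point of M serves as default value for the sections chosen below; over an empty M any [sigma]
   will do. *)
have [[y0 _]|nM] := pselect (exists y : M, True); last first.
  by exists (fun y _ => y) => y; case: nM; exists y.
have /choice[s sP] A : exists s : N -> M, V A ->
    [/\ smooth_on U s, s @` U = A & forall q, U q -> g (s q) = q].
  have [/sec[_ [s sP]]|nV] := pselect (V A); first by exists s.
  by exists (fun=> y0).
have /choice[sh shP] y : exists A : set M, U (g y) -> V A /\ A y.
  have [Uy|nU] := pselect (U (g y)); last by exists set0.
  have : (\bigcup_(A in V) A) y by rewrite VU.
  by move=> [A VA Ay]; exists A.
exists (fun y => s (sh y)) => y Uy; have [VA Ay] := shP y Uy.
have [[cs _] sU gs] := sP _ VA; split.
- by move=> q Uq; split; [exact: cs|exact: gs].
- have [q Uq e] : (s (sh y) @` U) y by rewrite sU.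
  by rewrite -[X in g X]e gs.
- have oA := (sec _ VA).1.
  have nU : \forall y' \near y, U (g y').
    by apply: (cg y I); exact: open_nbhs_nbhs.
  have := open_nbhs_nbhs (conj oA Ay); apply: filterS2 nU => y' Uy' Ay'.
  have [VA' Ay''] := shP y' Uy'.
  (* The point y' lies both on the sheet chosen for y and on its own, so disjointness identifies the
     two. *)
  by rewrite (tV _ _ VA' VA) //; exists y'.
Qed.

Section LocalDiffeo.
Context {M N : surface R} (g : M -> N) (covg : covering_map g).

Lemma covering_local_diffeo y :
  exists A B s, local_diffeo A B g s /\ A y.
Proof.
have [sg ev] := covg; have [U [V [oU Ub tV VU sec]]] := ev (g y).
have [A VA Ay] : (\bigcup_(A in V) A) y by rewrite VU.
have [oA [s [ss sU gs]]] := sec A VA.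
exists A, U, s; split=> //; split.
  by split=> //; exact: smooth_on_subset sg.
split.
  by move=> p; rewrite -{1}sU => -[q Uq <-]; rewrite gs.
by move=> q Uq; split; [rewrite -sU; exists q|exact: gs].
Qed.

Lemma covering_mdiff y : mdiff g y.
Proof. exact: (smooth_on_mdiff (A := setT) covg.1). Qed.

Lemma covering_tangent_inj y : injective (tangent_map g y).
Proof.
have [A [B [s [ld Ay]]]] := covering_local_diffeo y.
apply: (can_inj (g := tangent_map s (g y))) => u.
exact: tangent_local_diffeo ld Ay.
Qed.

Lemma covering_tangent_surj y w : exists u, tangent_map g y u = w.
Proof.
have [A [B [s [ld Ay]]]] := covering_local_diffeo y.
have [_ [h1 _]] := ld; have [Bgy sgy] := h1 y Ay.
exists (tangent_map s (g y) w).
have := tangent_local_diffeo w (local_diffeo_sym ld) Bgy.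
by rewrite sgy.
Qed.

(** A local smooth extension of u is pushed down by g, and one of [g \o u] is pulled up by a local
    section of g. The chain rule carries injectivity and the sign of the pulled-back form across. *)
Lemma oriented_immersed_disc_cover (omega : field2 N) (u : disc R -> M) :
  continuous u ->
  oriented_immersed_disc (pullback g omega) u <->
  oriented_immersed_disc omega (g \o u).
Proof.
move=> cu; split=> -[_ H]; split=> //.
  move=> x.
  exact: (@continuous_comp _ _ _ u g x (cu x) ((covering_mdiff (u x)).1)).
move=> z z1 z2.
  have [W [v [oW Wz sv vu [iv pv]]]] := H z z1 z2.
  have mv := smooth_on_mdiff sv Wz.
  have mg := covering_mdiff (v (\val z)).
  exists W, (g \o v); split; [exact: oW|exact: Wz| | |].
  + apply: (@smooth_on_comp _ plane M N W setT v g) => //; first exact: openT.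
    exact: covg.1.
  + by move=> z' Wz'; rewrite /= vu.
  + have [_ Tgv] := tangent_comp mv mg.
    split; last by rewrite (pullback_comp _ _ _ mv mg); exact: pv.
    by move=> a b; rewrite !Tgv => /covering_tangent_inj/iv.
move=> z z1 z2.
  have [W [v [oW Wz sv vu [iv pv]]]] := H z z1 z2.
  have [A [B [s [ld Az]]]] := covering_local_diffeo (u z).
  have [[oA oB _ ss] [h1 h2]] := ld.
  have nA := open_nbhs_nbhs (conj oA Az).
  (* The disc must stay in the sheet A near z; otherwise [s \o v] could extend a different lift of
     [g \o u]. *)
  have [W1 [oW1 W1z W1A]] := nbhs_set_typeP (cu _ _ nA).
  pose W2 := W `&` v @^-1` B.
  have oW2 : open W2 by apply: open_setI_preimage => //; exact: sv.1.
  pose W' := W2 `&` W1.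
  have oW' : open W' by exact: openI.
  have W'z : W' (\val z).
    by split=> //; split=> //; rewrite /= vu //=; have [] := h1 _ Az.
  have sv' : smooth_on (M := plane) W' v.
    by apply: smooth_on_subset sv => x [[]].
  have ssv : smooth_on (M := plane) W' (s \o v).
    apply: (@smooth_on_comp _ plane N M W' B v s oW' oB _ sv' ss).
    by move=> _ [x [[_ Bx] _] <-].
  have mv := smooth_on_mdiff sv' W'z.
  have msv := smooth_on_mdiff ssv W'z.
  have mg := covering_mdiff (s (v (\val z))).
  have E : \forall x \near (\val z : plane), v x = (g \o (s \o v)) x.
    have := open_nbhs_nbhs (conj oW' W'z).
    by apply: filterS => x [[_ /h2[_ /= ->]] _].
  have [_ T1] := tangent_near_eq E mv.
  have [_ T2] := tangent_comp msv mg.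
  exists W', (s \o v); split; [exact: oW'|exact: W'z|exact: ssv| |].
  + move=> z' [[Wz' Bz'] W1z']; rewrite /= vu //=.
    by have [] := h1 _ (W1A _ W1z').
  + split.
      by move=> a b ab; apply: iv; rewrite T1 !T2 ab.
    rewrite -(pullback_comp _ _ _ msv mg) /pullback -T1 -(nbhs_singleton E).
    exact: pv.
Qed.

End LocalDiffeo.

Lemma convex_corner_transport (M N : surface R) (A : set M) (B : set N)
    (phi : M -> N) (psi : N -> M) (L L' : topologicalType) (l : L -> M)
    (l' : L' -> M) (u : disc R -> M) z a b :
  local_diffeo A B phi psi -> A (u z) -> {for a, continuous l} ->
  {for b, continuous l'} -> {for z, continuous u} ->
  convex_corner l l' u z a b ->
  convex_corner (phi \o l) (phi \o l') (phi \o u) z a b.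
Proof.
move=> ld Az cl cl' cu [la [l'b [c [sc [cz c0] g1 g2 g3]]]].
have [[oA oB [cphi _] [cpsi _]] [h1 h2]] := ld.
have [Bz Kz] := h1 _ Az.
split; first by rewrite /= la.
split; first by rewrite /= l'b.
exists (transport_chart ld c).
have nA := open_nbhs_nbhs (conj oA Az).
have nB := open_nbhs_nbhs (conj oB Bz).
(* Both axes and the quadrant have the form of a condition P on the coordinates, so one statement
   serves the three germs. *)
have germ (T : topologicalType) (f : T -> M) t (P : set (R * R)) :
    {for t, continuous f} -> f t = u z ->
    image_germ f t [set q | cdom c q /\ P (cto c q)] ->
    image_germ (phi \o f) t
      [set q | cdom (transport_chart ld c) q /\
               P (cto (transport_chart ld c) q)].
  move=> cf ft; apply: (image_germ_comp (psi := psi)) => //; rewrite ft.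
  - exact: cphi.
  - exact: cpsi.
  - by apply: filterS nA => p /h1[].
  - by apply: filterS nB => q /h2[].
  - by apply: filterS nB => q Bq /=; split=> [[[]]|[]].
split.
- exact: transport_chart_smooth.
- by split; rewrite /= ?Kz //; split=> //=; rewrite Kz.
- exact: (germ _ l a [set x | x.2 = 0]).
- exact: (germ _ l' b [set x | x.1 = 0]).
- exact: (germ _ u z [set x | 0 <= x.1 /\ 0 <= x.2]).
Qed.

Lemma convex_corner_near_eq (M : surface R) (L L' : topologicalType)
    (l m : L -> M) (l' m' : L' -> M) (u w : disc R -> M) z a b :
  (\forall t \near a, l t = m t) -> (\forall t \near b, l' t = m' t) ->
  (\forall t \near z, u t = w t) ->
  convex_corner l l' u z a b -> convex_corner m m' w z a b.
Proof.
move=> lm lm' uw [la [l'b [c [sc c0 g1 g2 g3]]]].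
rewrite /convex_corner -(nbhs_singleton lm) -(nbhs_singleton lm').
rewrite -(nbhs_singleton uw); split=> //; split=> //; exists c; split=> //.
- exact: image_germ_near_eq lm g1.
- exact: image_germ_near_eq lm' g2.
- exact: image_germ_near_eq uw g3.
Qed.

(** Both directions are instances of [convex_corner_transport], along g and along its local inverse
    s. The way back yields a corner of [s \o (g \o u)], which agrees with u only near z. *)
Lemma convex_corner_cover (M N : surface R) (g : M -> N)
    (L L' : topologicalType) (l : L -> M) (l' : L' -> M) (u : disc R -> M)
    z a b : covering_map g ->
  {for a, continuous l} -> {for b, continuous l'} -> {for z, continuous u} ->
  l a = u z -> l' b = u z ->
  convex_corner l l' u z a b <->
  convex_corner (g \o l) (g \o l') (g \o u) z a b.
Proof.
move=> covg cl cl' cu la l'b.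
have [A [B [s [ld Az]]]] := covering_local_diffeo covg (u z).
split; first exact: convex_corner_transport ld Az cl cl' cu.
have [[oA oB _ _] [h1 h2]] := ld; have [Bz Kz] := h1 _ Az.
have nA := open_nbhs_nbhs (conj oA Az).
have cg x := (covering_mdiff covg x).1.
have near_id (T : topologicalType) (f : T -> M) t :
    {for t, continuous f} -> f t = u z ->
    \forall t' \near t, (s \o (g \o f)) t' = f t'.
  move=> cf ft; have nfA : nbhs (f t) A by rewrite ft.
  have fA : \forall t' \near t, A (f t') by exact: cf nfA.
  by apply: filterS fA => t' /h1[].
have gc (T : topologicalType) (f : T -> M) t :
    {for t, continuous f} -> {for t, continuous (g \o f)}.
  by move=> cf; exact: (@continuous_comp _ _ _ f g t cf (cg (f t))).
move=> /(convex_corner_transport (local_diffeo_sym ld) Bz (gc _ _ _ cl)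
  (gc _ _ _ cl') (gc _ _ _ cu)).
by apply: convex_corner_near_eq; exact: near_id.
Qed.

End Coverings.

(** * Pullbacks, the disc and its boundary arcs *)

Definition sub_pt (X : Type) (A : set X) (x : X) (Ax : A x) : A :=
  exist _ x (mem_set Ax).

Lemma continuous_subtype (X T : topologicalType) (A : set X) (f : T -> A) :
  continuous (fun t => \val (f t)) -> continuous f.
Proof. by move=> cf; exact: (@continuous_comp_initial _ _ _ set_val f). Qed.

Lemma continuous_val (X : topologicalType) (A : set X) :
  continuous (fun a : A => \val a).
Proof. by move=> x; exact: (@initial_continuous _ _ set_val). Qed.

Lemma continuous_fst_comp (T U V : topologicalType) (f : T -> U * V) x :
  {for x, continuous f} -> {for x, continuous (fun y => (f y).1)}.
Proof.
by move=> cf; apply: (@continuous_comp _ _ _ f fst x cf); exact: cvg_fst.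
Qed.

Lemma continuous_snd_comp (T U V : topologicalType) (f : T -> U * V) x :
  {for x, continuous f} -> {for x, continuous (fun y => (f y).2)}.
Proof.
by move=> cf; apply: (@continuous_comp _ _ _ f snd x cf); exact: cvg_snd.
Qed.

Section Pullback.
Context {F B K Q : topologicalType}.

(* The last clause says that Q carries the initial topology of (m, pr). *)
Definition is_pullback (g : F -> B) (k : K -> B) (m : Q -> F) (pr : Q -> K) :
    Prop :=
  [/\ continuous m, continuous pr, forall q, k (pr q) = g (m q) &
   [/\ forall q q', m q = m q' -> pr q = pr q' -> q = q',
       forall y x, g y = k x -> exists q, m q = y /\ pr q = x &
       forall q V, nbhs q V -> exists V1 V2, [/\ nbhs (m q) V1,
         nbhs (pr q) V2 & forall q', V1 (m q') -> V2 (pr q') -> V q']]].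

Variables (g : F -> B) (k : K -> B) (m : Q -> F) (pr : Q -> K).
Hypothesis pb : is_pullback g k m pr.

(** The values of c are chosen pointwise; continuity follows because Q carries the initial
    topology. *)
Lemma pullback_lift (S : topologicalType) (a : S -> F) (b : S -> K) :
  continuous a -> continuous b -> (forall s, g (a s) = k (b s)) ->
  exists c : S -> Q, [/\ continuous c, forall s, m (c s) = a s &
    forall s, pr (c s) = b s].
Proof.
have [_ _ _ [_ ex nb]] := pb => ca cb e.
have /choice[c cP] s := ex _ _ (e s).
exists c; split=> [s V /nb[V1 [V2 [n1 n2 H]]]|s|s]; [|by case: (cP s)..].
have [e1 e2] := cP s; rewrite e1 in n1; rewrite e2 in n2.
have h1 : \forall t \near s, V1 (a t) by exact: ca n1.
have h2 : \forall t \near s, V2 (b t) by exact: cb n2.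
apply: filterS2 h1 h2 => t; have [<- <-] := cP t.
exact: H.
Qed.

(** Through q, the projection has the local section sending x to the point over [sigma (m q) (k x)]
    and x: the pullback of a covering is again locally sectioned. *)
Lemma pullback_open_proj : top_covering g -> continuous k ->
  forall q V, nbhs q V -> nbhs (pr q) (pr @` V).
Proof.
move=> [cg cov] ck; have [_ cpr comm [_ ex nb]] := pb.
move=> q V /nb[V1 [V2 [n1 n2 H]]].
have [U nU [sigma tr]] := cov (g (m q)).
have [h1 h2 _] := tr _ (nbhs_singleton nU).
rewrite -comm in nU.
have h3 : \forall x \near pr q, U (k x) by exact: ck nU.
have h4 : \forall x \near pr q, V1 (sigma (m q) (k x)).
  have [cs _] := h1 _ (nbhs_singleton nU).
  have n1' : nbhs (sigma (m q) (k (pr q))) V1 by rewrite comm h2.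
  exact: (@cvg_comp _ _ _ k (sigma (m q)) _ _ _ (ck (pr q)) cs) n1'.
apply: filterS3 h3 h4 n2 => x Ux V1x V2x.
have [_ gs] := h1 _ Ux.
have [q' [mq' prq']] := ex _ _ gs.
by exists q' => //; apply: H; rewrite ?mq' ?prq'.
Qed.

End Pullback.

Lemma fiber_product_pullback_snd (K F B : topologicalType) (k : K -> B)
    (g : F -> B) :
  is_pullback g k (fun q : fiber_product k g => (\val q).2)
    (fun q : fiber_product k g => (\val q).1).
Proof.
split.
- by move=> q; apply: continuous_snd_comp; exact: continuous_val.
- by move=> q; apply: continuous_fst_comp; exact: continuous_val.
- by move=> q; exact: (set_valP q).
split.
- move=> q q' e1 e2; apply: val_inj.
  by rewrite [LHS]surjective_pairing e1 e2 -surjective_pairing.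
- move=> y x e; have h : fiber_product k g (x, y) by [].
  by exists (sub_pt h).
- move=> q V /nbhs_set_typeP[W [oW Wq WV]].
  have [[V1 V2] /= [n1 n2] H] := open_nbhs_nbhs (conj oW Wq).
  exists V2; exists V1; split=> // q' h1 h2; apply: WV; apply: H; split.
    exact: h2.
  exact: h1.
Qed.

Lemma fiber_product_pullback_fst (K F B : topologicalType) (g : F -> B)
    (k : K -> B) :
  is_pullback g k (fun q : fiber_product g k => (\val q).1)
    (fun q : fiber_product g k => (\val q).2).
Proof.
split.
- by move=> q; apply: continuous_fst_comp; exact: continuous_val.
- by move=> q; apply: continuous_snd_comp; exact: continuous_val.
- by move=> q; exact: (esym (set_valP q)).
split.
- move=> q q' e1 e2; apply: val_inj.
  by rewrite [LHS]surjective_pairing e1 e2 -surjective_pairing.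
- move=> y x e; have h : fiber_product g k (y, x) by [].
  by exists (sub_pt h).
- move=> q V /nbhs_set_typeP[W [oW Wq WV]].
  have [[V1 V2] /= [n1 n2] H] := open_nbhs_nbhs (conj oW Wq).
  by exists V1; exists V2; split=> // q' h1 h2; apply: WV; apply: H; split.
Qed.

(** * Lifting discs by contraction to (1,0), and paths in the boundary arcs *)

Section Disc.
Context {R : realType}.

Definition clamp (a b t : R) : R := Num.max a (Num.min t b).

Lemma continuous_clamp a b : continuous (clamp a b).
Proof.
move=> x; apply: (@continuous_comp _ _ _ (fun s => Num.min s b) (Num.max a)).
  exact: continuous_minr.
exact: continuous_maxl.
Qed.

Lemma clamp_itv a b t : a <= b -> a <= clamp a b t <= b.
Proof.
by move=> ab; rewrite le_max lexx /= ge_max ab /= ge_min lexx orbT.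
Qed.

Lemma clamp_id a b t : a <= t <= b -> clamp a b t = t.
Proof. by move=> /andP[at_ tb]; rewrite /clamp min_l // max_r. Qed.

Lemma disc_right : disc R (1, 0).
Proof. by rewrite /disc /= expr1n expr0n addr0. Qed.

Definition right_pt : disc R := sub_pt disc_right.

Lemma disc_left : disc R (-1, 0).
Proof. by rewrite /disc /= sqrrN expr1n expr0n addr0. Qed.

Definition left_pt : disc R := sub_pt disc_left.

(** The straight-line contraction of the disc onto (1,0), with time clamped to [0, 1] so that it is
    constant outside, as [homotopy_lift] requires. *)
Definition segment_map (x : disc R * R) : R * R :=
  ((1 - clamp 0 1 x.2) + clamp 0 1 x.2 * (\val x.1).1,
   clamp 0 1 x.2 * (\val x.1).2).

Lemma segment_map_disc x : disc R (segment_map x).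
Proof.
have := clamp_itv x.2 (@ler01 R); rewrite /segment_map.
have : disc R (\val x.1) by exact: (set_valP x.1).
rewrite /disc /=; case: (\val x.1) => a b /=.
move: (clamp 0 1 x.2) => c ab /andP[c0 c1].
have a1 : a <= 1.
  by have := sqr_ge0 b; have := sqr_ge0 (a - 1); rewrite !expr2 in ab *; lra.
(* One minus the squared norm of the point equals c^2 (1 - a^2 - b^2) + 2 c (1 - c) (1 - a); h1 and
   h2 are the signs of the two terms. *)
have h1 := mulr_ge0 (mulr_ge0 c0 c0) (_ : 0 <= 1 - (a ^+ 2 + b ^+ 2)).
have {}h1 : 0 <= c * c * (1 - (a ^+ 2 + b ^+ 2)) by apply: h1; lra.
have h2 : 0 <= c * (1 - c) * (1 - a).
  by apply: mulr_ge0; [apply: mulr_ge0 => //|]; lra.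
nra.
Qed.

Definition disc_segment (x : disc R * R) : disc R :=
  sub_pt (segment_map_disc x).

Lemma continuous_disc_segment : continuous disc_segment.
Proof.
apply: continuous_subtype => x.
have cc : {for x, continuous (fun x : disc R * R => clamp 0 1 x.2)}.
  apply: (@continuous_comp _ _ _ snd (clamp 0 1)); first exact: cvg_snd.
  exact: continuous_clamp.
have cv : {for x, continuous (fun x : disc R * R => \val x.1)}.
  apply: (@continuous_comp _ _ _ fst (fun z : disc R => \val z)).
    exact: cvg_fst.
  exact: continuous_val.
have c1 : {for x, continuous (fun x : disc R * R =>
    (1 - clamp 0 1 x.2) + clamp 0 1 x.2 * (\val x.1).1 : R)}.
  apply: cvgD; first by apply: cvgB; [exact: cvg_cst|exact: cc].
  by apply: cvgM; [exact: cc|exact: continuous_fst_comp cv].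
have c2 : {for x, continuous (fun x : disc R * R =>
    clamp 0 1 x.2 * (\val x.1).2 : R)}.
  by apply: cvgM; [exact: cc|exact: continuous_snd_comp cv].
exact: (continuous_pair c1 c2).
Qed.

Lemma disc_segment0 z t : t <= 0 -> disc_segment (z, t) = right_pt.
Proof.
move=> t0; apply: val_inj; rewrite /= /segment_map /=.
have -> : clamp 0 1 t = 0 by rewrite /clamp max_l // ge_min t0.
by rewrite subr0 !mul0r addr0.
Qed.

Lemma disc_segment1 z t : 1 <= t -> disc_segment (z, t) = z.
Proof.
move=> t1; apply: val_inj; rewrite /= /segment_map /=.
have -> : clamp 0 1 t = 1 by rewrite /clamp min_r // max_r.
by rewrite subrr !mul1r add0r -surjective_pairing.
Qed.

Lemma disc_lift_unique (F B : topologicalType) (g : F -> B)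
    (l1 l2 : disc R -> F) : top_covering g -> continuous l1 -> continuous l2 ->
  (forall z, g (l1 z) = g (l2 z)) -> l1 right_pt = l2 right_pt -> l1 = l2.
Proof.
move=> cov c1 c2 e e0; apply/funext => z.
have c : continuous (fun t => disc_segment (z, t)).
  exact/continuous_partial_r/continuous_disc_segment.
have := @lift_unique R _ _ g cov _ l1 l2 _ 0 1 c1 c2 e c.
by rewrite (disc_segment0 z (lexx 0)) (disc_segment1 z (lexx 1)); exact.
Qed.

Lemma disc_lift (F B : topologicalType) (g : F -> B) (u : disc R -> B) y :
  top_covering g -> continuous u -> g y = u right_pt ->
  exists l : disc R -> F,
    [/\ continuous l, l right_pt = y & forall z, g (l z) = u z].
Proof.
move=> cov cu gy.
have ch : continuous (u \o disc_segment).
  move=> x; apply: continuous_comp; [exact: continuous_disc_segment|exact: cu].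
have [||||H [cH H0 gH]] := homotopy_lift cov (l0 := fun=> y) ch.
- by move=> z t t0; rewrite /= !disc_segment0.
- by move=> z t t1; rewrite /= !disc_segment1.
- exact: cst_continuous.
- by move=> z; rewrite /= disc_segment0.
exists (fun z => H (z, 1)); split.
- by move=> z; exact/continuous_partial_l/cH.
(* The lift is known to be y at time 0 and is wanted at time 1. The segment from (1,0) to itself is
   constant, so its lift is the constant one. *)
- have := @lift_unique R _ _ g cov R
    (fun t => H (right_pt, t)) (fun=> y) id 0 1.
  rewrite H0; apply=> //.
  + exact: continuous_partial_r.
  + exact: cst_continuous.
  + move=> s; rewrite gH gy /=; congr u; apply: val_inj.
    by rewrite /= /segment_map /= mulr1 mulr0 subrK.
  + by move=> t; exact: cvg_id.
- by move=> z; rewrite gH /= disc_segment1.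
Qed.

(** What uniqueness of lifts along an arc asks for: every point is joined, inside the arc, to (1,0),
    where the lifts are compared. *)
Definition joined_arc (arc : set (R * R)) : Prop :=
  arc `<=` disc R /\ forall s : arc, exists (c : R -> arc) (t1 t2 : R),
    [/\ continuous c, \val (c t1) = (1, 0) & c t2 = s].

Lemma continuous_sqrt_clamp :
  continuous (fun t => Num.sqrt (1 - clamp (-1) 1 t ^+ 2)).
Proof.
move=> t.
have ck : {for t, continuous (clamp (-1) 1)} by exact: continuous_clamp.
apply: (@continuous_comp _ _ _ (fun t => 1 - clamp (-1) 1 t ^+ 2) Num.sqrt).
  by apply: cvgB; [exact: cvg_cst|apply: cvgM; exact: ck].
exact: sqrt_continuous.
Qed.

Lemma joined_upper_arc : joined_arc (upper_arc R).
Proof.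
split=> [z [] + _|[[a b] s]]; first by rewrite /disc /= => ->.
pose k t := clamp (-1) 1 t.
have k1 t : 0 <= 1 - k t ^+ 2.
  have : -1 <= k t <= 1 by apply: clamp_itv; lra.
  by move=> /andP[]; nra.
have arcP t : upper_arc R (k t, Num.sqrt (1 - k t ^+ 2)).
  by split; rewrite /= ?sqrtr_ge0 // sqr_sqrtr // subrKC.
(* The arc is a graph over the first coordinate: t = 1 gives (1,0) and t = a gives the chosen
   point. *)
exists (fun t => sub_pt (arcP t)), 1, a; split.
- apply: continuous_subtype => t.
  have ck : {for t, continuous k} by exact: continuous_clamp.
  have cs : {for t, continuous (fun t => Num.sqrt (1 - k t ^+ 2))}.
    exact: continuous_sqrt_clamp.
  exact: (continuous_pair ck cs).
- by rewrite /= /k clamp_id ?lexx ?andbT; [rewrite expr1n subrr sqrtr0|lra].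
- apply: val_inj => /=; have [/= ab b0] := set_mem s.
  have ka : k a = a by apply: clamp_id; apply/andP; nra.
  rewrite ka; congr pair.
  by rewrite -ab addrAC subrr add0r sqrtr_sqr ger0_norm.
Qed.

Lemma joined_lower_arc : joined_arc (lower_arc R).
Proof.
split=> [z [] + _|[[a b] s]]; first by rewrite /disc /= => ->.
pose k t := clamp (-1) 1 t.
have k1 t : 0 <= 1 - k t ^+ 2.
  have : -1 <= k t <= 1 by apply: clamp_itv; lra.
  by move=> /andP[]; nra.
have arcP t : lower_arc R (k t, - Num.sqrt (1 - k t ^+ 2)).
  by split; rewrite /= ?oppr_le0 ?sqrtr_ge0 // sqrrN sqr_sqrtr // subrKC.
exists (fun t => sub_pt (arcP t)), 1, a; split.
- apply: continuous_subtype => t.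
  have ck : {for t, continuous k} by exact: continuous_clamp.
  have cs : {for t, continuous (fun t => Num.sqrt (1 - k t ^+ 2))}.
    exact: continuous_sqrt_clamp.
  have cNs : {for t, continuous (fun t => - Num.sqrt (1 - k t ^+ 2))}.
    exact: cvgN cs.
  exact: (continuous_pair ck cNs).
- rewrite /= /k clamp_id ?lexx ?andbT; last by lra.
  by rewrite expr1n subrr sqrtr0 oppr0.
- apply: val_inj => /=; have [/= ab b0] := set_mem s.
  have ka : k a = a by apply: clamp_id; apply/andP; nra.
  rewrite ka; congr pair.
  by rewrite -ab addrAC subrr add0r sqrtr_sqr ler0_norm // opprK.
Qed.

End Disc.

(** * Boundary arcs and corners under coverings and pullbacks *)

Section ArcLifts.
Context {R : realType} {M N : surface R} {g : M -> N}.
Hypothesis covg : covering_map g.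
Variables (arc : set (R * R)) (ja : joined_arc arc).

Definition arc_incl (s : arc) : disc R := sub_pt (ja.1 _ (set_valP s)).

Lemma continuous_arc_incl : continuous arc_incl.
Proof. by apply: continuous_subtype; exact: continuous_val. Qed.

Lemma arc_inclE (s : arc) (z : disc R) : \val s = \val z -> z = arc_incl s.
Proof. by move=> e; apply: val_inj; rewrite -e. Qed.

(** Along the arc, [l \o a] and u lift the same arc of N and agree at (1,0), hence coincide. *)
Lemma lifts_over_lift (K : topologicalType) (l : K -> M) (u : disc R -> M)
    k k' : continuous l -> continuous u -> l k = u right_pt ->
  lifts_over arc (g \o l) (g \o u) k k' <-> lifts_over arc l u k k'.
Proof.
move=> cl cu lk; split=> -[a [ca ga a1 a2]]; exists a; split=> //; last first.
  by move=> s z sz; rewrite /= (ga s z sz).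
move=> s z /arc_inclE ->; have [c [t1 [t2 [cc c1 <-]]]] := ja.2 s.
apply: (@lift_unique R _ _ g (covering_top covg) _ (l \o a) (u \o arc_incl)
  c t1 t2) => //.
- by move=> x; apply: continuous_comp; [exact: ca|exact: cl].
- by move=> x; apply: continuous_comp; [exact: continuous_arc_incl|exact: cu].
- by move=> s'; exact: ga.
- by rewrite /= (a1 _ c1) lk; congr u; apply: val_inj; rewrite /= c1.
Qed.

(** An arc in K over [g \o u], paired with u itself, is an arc in Q. Its endpoints are x and y
    because a point of Q is determined by its images in M and K. *)
Lemma lifts_over_pullback (K Q : topologicalType) (k : K -> N) (m : Q -> M)
    (pr : Q -> K) (u : disc R -> M) x y : is_pullback g k m pr ->
  continuous u -> m x = u right_pt -> m y = u left_pt ->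
  lifts_over arc k (g \o u) (pr x) (pr y) <-> lifts_over arc m u x y.
Proof.
move=> pb cu mx my; have [cm cpr comm [inj _ _]] := pb.
split=> -[a [ca ga a1 a2]].
  have cua : continuous (u \o arc_incl).
    by move=> s; apply: continuous_comp; [exact: continuous_arc_incl|exact: cu].
  have [|c [cc mc prc]] := pullback_lift pb cua ca.
    by move=> s; rewrite (ga s (arc_incl s)).
  exists c; split=> //.
  - by move=> s z /arc_inclE ->; rewrite mc.
  - move=> s s1; apply: inj; last by rewrite prc a1.
    by rewrite mc mx /=; congr u; apply: val_inj.
  - move=> s s1; apply: inj; last by rewrite prc a2.
    by rewrite mc my /=; congr u; apply: val_inj.
exists (pr \o a); split.
- by move=> s; apply: continuous_comp; [exact: ca|exact: cpr].
- by move=> s z sz; rewrite /= comm (ga s z sz).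
- by move=> s s1; rewrite /= a1.
- by move=> s s1; rewrite /= a2.
Qed.

Lemma lifts_over_left (K : topologicalType) (l : K -> M) (u : disc R -> M)
    k k' : arc (-1, 0) -> lifts_over arc l u k k' -> l k' = u left_pt.
Proof.
by move=> al [a [_ ga _ a2]]; rewrite -(a2 (sub_pt al)) // (ga _ left_pt).
Qed.

(** Since [g \o m = k \o pr] and pr is open, the branch of K at [pr b] and that of Q at b have the
    same germ of image. *)
Lemma convex_corner_pullback_r (K P Q : topologicalType) (k : K -> N)
    (m : Q -> M) (pr : Q -> K) (l : P -> N) w z a b :
  is_pullback g k m pr -> continuous k ->
  convex_corner l k w z a (pr b) <-> convex_corner l (g \o m) w z a b.
Proof.
move=> pb ck; have [cm cpr comm _] := pb.
have E : g \o m = k \o pr by apply/funext => q; rewrite /= comm.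
have op := pullback_open_proj pb (covering_top covg) ck (q := b).
rewrite E; split=> -[h1 [h2 [c [h3 h4 h5 h6 h7]]]];
  split=> //; split=> //; exists c; split=> //.
  by apply/(image_germ_open k _ (cpr b) op).
by apply/(image_germ_open k _ (cpr b) op).
Qed.

Lemma convex_corner_pullback_l (K P Q : topologicalType) (k : K -> N)
    (m : Q -> M) (pr : Q -> K) (l : P -> N) w z a b :
  is_pullback g k m pr -> continuous k ->
  convex_corner k l w z (pr a) b <-> convex_corner (g \o m) l w z a b.
Proof.
move=> pb ck; have [cm cpr comm _] := pb.
have E : g \o m = k \o pr by apply/funext => q; rewrite /= comm.
have op := pullback_open_proj pb (covering_top covg) ck (q := a).
rewrite E; split=> -[h1 [h2 [c [h3 h4 h5 h6 h7]]]];
  split=> //; split=> //; exists c; split=> //.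
  by apply/(image_germ_open k _ (cpr a) op).
by apply/(image_germ_open k _ (cpr a) op).
Qed.

End ArcLifts.

(** * Composability, and equality of the two pulled-back forms *)

Section Transversality.
Context {R : realType} {F F1 F2 : surface R} {L1 L2 : curve R}.
Variables (g1 : F -> F1) (g2 : F -> F2) (f1 : L1 -> F1) (f2 : L2 -> F2).
Hypotheses (hg1 : covering_map g1) (hg2 : covering_map g2).
Hypotheses (hf1 : smooth f1) (hf2 : smooth f2).

Let mg1 y : mdiff g1 y := covering_mdiff hg1 y.
Let mg2 y : mdiff g2 y := covering_mdiff hg2 y.

Lemma covering_composable_left : composable_left g1 g2 f1.
Proof.
move=> [a y] [b c] _ [w1 [w2 w3]].
have mf : mdiff f1 a by exact: (smooth_on_mdiff (A := setT) hf1).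
have [mfst Tfst] := @tangent_fst _ _ _ L1 F (a, y).
have [msnd Tsnd] := @tangent_snd _ _ _ L1 F (a, y).
have [m1 T1] := tangent_comp mfst (mf : mdiff f1 (fst (a, y))).
have [m2 T2] := tangent_comp msnd (mg1 (snd (a, y))).
have [m3 T3] := tangent_comp msnd (mg2 (snd (a, y))).
have [m4 T4] := tangent_pair m2 m3.
have [_ T5] := tangent_pair m1 m4.
have [nfst Ufst] := @tangent_fst _ _ _ F1 F2 (b, c).
have [nsnd Usnd] := @tangent_snd _ _ _ F1 F2 (b, c).
have [n1 U1] := tangent_pair nfst nsnd.
have [_ U2] := tangent_pair nfst n1.
(* Moving in F alone is enough: v1 settles the first component, t the second because the
   differential of g1 is onto, and the free F2-direction absorbs the third. The differential of f1
   at 0 is carried along unsimplified. *)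
pose v1 := w1 - tangent_map f1 a 0.
have [t Tt] := covering_tangent_surj hg1 y (w2 - v1).
exists (0, t), (v1, w3 - tangent_map g2 y t).
have S1 u : tangent_map (M := prod_manifold L1 F)
    (N := prod_manifold F1 (prod_manifold F1 F2))
    (fun q => (f1 q.1, (g1 q.2, g2 q.2))) (a, y) u =
    (tangent_map f1 a u.1, (tangent_map g1 y u.2, tangent_map g2 y u.2)).
  by apply: eq_trans (T5 u) _; rewrite T4 T1 T2 T3 Tfst Tsnd.
have S2 v : tangent_map (M := prod_manifold F1 F2)
    (N := prod_manifold F1 (prod_manifold F1 F2))
    (fun q => (q.1, (q.1, q.2))) (b, c) v = (v.1, (v.1, v.2)).
  by apply: eq_trans (U2 v) _; rewrite U1 Ufst Usnd.
rewrite [X in _ = X + _](S1 (0, t)) [X in _ = _ + X]S2 /= Tt.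
by congr (_, (_, _)); rewrite /= /v1 ?subrK // addrC subrK.
Qed.

Lemma covering_composable_right : composable_right g1 g2 f2.
Proof.
move=> [y a] [b c] _ [[w1 w2] w3].
have mf : mdiff f2 a by exact: (smooth_on_mdiff (A := setT) hf2).
have [mfst Tfst] := @tangent_fst _ _ _ F L2 (y, a).
have [msnd Tsnd] := @tangent_snd _ _ _ F L2 (y, a).
have [m1 T1] := tangent_comp msnd (mf : mdiff f2 (snd (y, a))).
have [m2 T2] := tangent_comp mfst (mg1 (fst (y, a))).
have [m3 T3] := tangent_comp mfst (mg2 (fst (y, a))).
have [m4 T4] := tangent_pair m2 m3.
have [_ T5] := tangent_pair m4 m1.
have [nfst Ufst] := @tangent_fst _ _ _ F1 F2 (b, c).
have [nsnd Usnd] := @tangent_snd _ _ _ F1 F2 (b, c).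
have [n1 U1] := tangent_pair nfst nsnd.
have [_ U2] := tangent_pair n1 nsnd.
pose v2 := w3 - tangent_map f2 a 0.
have [t Tt] := covering_tangent_surj hg2 y (w2 - v2).
exists (t, 0), (w1 - tangent_map g1 y t, v2).
have S1 u : tangent_map (M := prod_manifold F L2)
    (N := prod_manifold (prod_manifold F1 F2) F2)
    (fun q => ((g1 q.1, g2 q.1), f2 q.2)) (y, a) u =
    ((tangent_map g1 y u.1, tangent_map g2 y u.1), tangent_map f2 a u.2).
  by apply: eq_trans (T5 u) _; rewrite T4 T1 T2 T3 Tfst Tsnd.
have S2 v : tangent_map (M := prod_manifold F1 F2)
    (N := prod_manifold (prod_manifold F1 F2) F2)
    (fun q => ((q.1, q.2), q.2)) (b, c) v = ((v.1, v.2), v.2).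
  by apply: eq_trans (U2 v) _; rewrite U1 Ufst Usnd.
rewrite [X in _ = X + _](S1 (t, 0)) [X in _ = _ + X]S2 /= Tt.
by congr ((_, _), _); rewrite /= /v2 ?subrK // addrC subrK.
Qed.

Lemma lagrangian_pullback_eq (omega1 : field2 F1) (omega2 : field2 F2) :
  lagrangian_immersion (M := F) (X := prod_manifold F1 F2)
    (prod_form omega1 omega2) (fun y => (g1 y, g2 y)) ->
  pullback g1 omega1 = pullback g2 omega2.
Proof.
move=> [_ lag]; apply/funext => p; apply/funext => u; apply/funext => v.
have := lag p u v.
have [_ T1] := tangent_pair (mg1 p) (mg2 p).
have [_ Tfst] := @tangent_fst _ _ _ F1 F2 (g1 p, g2 p).
have [_ Tsnd] := @tangent_snd _ _ _ F1 F2 (g1 p, g2 p).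
rewrite {1}/pullback /prod_form {1}/pullback [X in _ - X]/pullback.
rewrite !T1 !Tfst !Tsnd /= => /eqP; rewrite subr_eq0 => /eqP.
by [].
Qed.

End Transversality.

(** * Transfer of bigons *)

Section BigonTransfer.
Context {R : realType} {M N : surface R} {g : M -> N}.
Hypothesis covg : covering_map g.
Variable omega : field2 N.
Context {K P Q : topologicalType} {k : K -> N} {m : Q -> M} {pr : Q -> K}.
Hypotheses (pb : is_pullback g k m pr) (ck : continuous k).
Variables (l : P -> M) (cl : continuous l).
Variables (u : disc R -> M) (cu : continuous u).

(** Collects the conditions on a bigon other than x <> y. Downstairs the curves are [g \o l] and k,
    upstairs l and the pullback m of k; the intersections (p, a) and (q, b) upstairs lie over (p, pr
    a) and (q, pr b). *)
Lemma bigon_transfer_right p q a b :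
  l p = u right_pt -> m a = l p -> m b = l q ->
  [/\ oriented_immersed_disc omega (g \o u),
      lifts_over (upper_arc R) (g \o l) (g \o u) p q /\
      lifts_over (lower_arc R) k (g \o u) (pr a) (pr b),
      forall z : disc R, \val z = (1, 0) ->
        convex_corner (g \o l) k (g \o u) z p (pr a) &
      forall z : disc R, \val z = (-1, 0) ->
        convex_corner (g \o l) k (g \o u) z q (pr b)] <->
  [/\ oriented_immersed_disc (pullback g omega) u,
      lifts_over (upper_arc R) l u p q /\ lifts_over (lower_arc R) m u a b,
      forall z : disc R, \val z = (1, 0) -> convex_corner l m u z p a &
      forall z : disc R, \val z = (-1, 0) -> convex_corner l m u z q b].
Proof.
move=> lp ma mb; have [cm _ _ _] := pb.
have upper := lifts_over_lift covg (joined_upper_arc (R := R)) q cl cu lp.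
have left_in : upper_arc R (-1, 0).
  by split; rewrite /= ?lexx // sqrrN expr1n expr0n addr0.
have lower : l q = u left_pt ->
    lifts_over (lower_arc R) k (g \o u) (pr a) (pr b) <->
    lifts_over (lower_arc R) m u a b.
  move=> lq; apply: (lifts_over_pullback (joined_lower_arc (R := R)) pb cu).
    by rewrite ma.
  by rewrite mb.
have corner z p' a' : l p' = u z -> m a' = u z ->
    convex_corner (g \o l) k (g \o u) z p' (pr a') <->
    convex_corner l m u z p' a'.
  move=> lp' ma'.
  have h1 := convex_corner_pullback_r covg (g \o l) (g \o u) z p' a' pb ck.
  have h2 := convex_corner_cover covg (@cl p') (@cm a') (@cu z) lp' ma'.
  exact: iff_trans h1 (iff_sym h2).
have right_eq (z : disc R) : \val z = (1, 0) -> z = right_pt.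
  by move=> e; apply: val_inj.
have left_eq (z : disc R) : \val z = (-1, 0) -> z = left_pt.
  by move=> e; apply: val_inj.
split=> -[h1 [h2 h3] h4 h5].
  (* The arc on the curve l must be lifted first: it shows that u takes the value l q at (-1,0),
     which the pulled-back arc and the second corner rely on. *)
  have h2' := upper.1 h2; have lq := lifts_over_left left_in h2'.
  split.
  - exact/(oriented_immersed_disc_cover covg).
  - by split=> //; exact/(lower lq).
  - by move=> z /[dup] /right_eq -> /h4 /corner; apply; rewrite ?ma.
  - by move=> z /[dup] /left_eq -> /h5 /corner; apply; rewrite ?mb.
have lq := lifts_over_left left_in h2.
split.
- exact/(oriented_immersed_disc_cover covg).
- by split; [exact/upper|exact/(lower lq)].
- by move=> z /[dup] /right_eq -> /h4 /corner; apply; rewrite ?ma.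
- by move=> z /[dup] /left_eq -> /h5 /corner; apply; rewrite ?mb.
Qed.

(** The mirror image, with the pulled-back curve on the upper arc. It serves for g1, where L1 is the
    curve pulled back to F. *)
Lemma bigon_transfer_left p q a b :
  l p = u right_pt -> m a = l p -> m b = l q ->
  [/\ oriented_immersed_disc omega (g \o u),
      lifts_over (upper_arc R) k (g \o u) (pr a) (pr b) /\
      lifts_over (lower_arc R) (g \o l) (g \o u) p q,
      forall z : disc R, \val z = (1, 0) ->
        convex_corner k (g \o l) (g \o u) z (pr a) p &
      forall z : disc R, \val z = (-1, 0) ->
        convex_corner k (g \o l) (g \o u) z (pr b) q] <->
  [/\ oriented_immersed_disc (pullback g omega) u,
      lifts_over (upper_arc R) m u a b /\ lifts_over (lower_arc R) l u p q,
      forall z : disc R, \val z = (1, 0) -> convex_corner m l u z a p &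
      forall z : disc R, \val z = (-1, 0) -> convex_corner m l u z b q].
Proof.
move=> lp ma mb; have [cm _ _ _] := pb.
have lower := lifts_over_lift covg (joined_lower_arc (R := R)) q cl cu lp.
have left_in : lower_arc R (-1, 0).
  by split; rewrite /= ?lexx // sqrrN expr1n expr0n addr0.
have upper : l q = u left_pt ->
    lifts_over (upper_arc R) k (g \o u) (pr a) (pr b) <->
    lifts_over (upper_arc R) m u a b.
  move=> lq; apply: (lifts_over_pullback (joined_upper_arc (R := R)) pb cu).
    by rewrite ma.
  by rewrite mb.
have corner z p' a' : l p' = u z -> m a' = u z ->
    convex_corner k (g \o l) (g \o u) z (pr a') p' <->
    convex_corner m l u z a' p'.
  move=> lp' ma'.
  have h1 := convex_corner_pullback_l covg (g \o l) (g \o u) z a' p' pb ck.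
  have h2 := convex_corner_cover covg (@cm a') (@cl p') (@cu z) ma' lp'.
  exact: iff_trans h1 (iff_sym h2).
have right_eq (z : disc R) : \val z = (1, 0) -> z = right_pt.
  by move=> e; apply: val_inj.
have left_eq (z : disc R) : \val z = (-1, 0) -> z = left_pt.
  by move=> e; apply: val_inj.
split=> -[h1 [h2 h3] h4 h5].
  have h3' := lower.1 h3; have lq := lifts_over_left left_in h3'.
  split.
  - exact/(oriented_immersed_disc_cover covg).
  - by split=> //; exact/(upper lq).
  - by move=> z /[dup] /right_eq -> /h4 /corner; apply; rewrite ?ma.
  - by move=> z /[dup] /left_eq -> /h5 /corner; apply; rewrite ?mb.
have lq := lifts_over_left left_in h3.
split.
- exact/(oriented_immersed_disc_cover covg).
- by split; [exact/(upper lq)|exact/lower].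
- by move=> z /[dup] /right_eq -> /h4 /corner; apply; rewrite ?ma.
- by move=> z /[dup] /left_eq -> /h5 /corner; apply; rewrite ?mb.
Qed.

End BigonTransfer.

Lemma bigon_eq (R : realType) (X : surface R) (omega : field2 X)
    (L L' : topologicalType) (f : L -> X) (f' : L' -> X)
    (b b' : bigon omega f f') :
  bigon_map b = bigon_map b' -> bigon_src b = bigon_src b' ->
  bigon_tgt b = bigon_tgt b' -> b = b'.
Proof.
case: b b' => [u x y P] [u' x' y' P'] /= eu ex ey.
by subst u' x' y'; congr Bigon; exact: Prop_irrelevance.
Qed.

(** * The bijections of intersections and of bigons *)

Section Correspondence.
Context {R : realType} {F F1 F2 : surface R} {L1 L2 : curve R}.
Context {omega1 : field2 F1} {omega2 : field2 F2}.
Variables (g1 : F -> F1) (g2 : F -> F2) (f1 : L1 -> F1) (f2 : L2 -> F2).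
Hypotheses (hg1 : covering_map g1) (hg2 : covering_map g2).
Hypotheses (cf1 : continuous f1) (cf2 : continuous f2).
Hypothesis homega : pullback g1 omega1 = pullback g2 omega2.

Local Notation P1 := (fiber_product f1 g1).
Local Notation P2 := (fiber_product g2 f2).
Local Notation PL := (fiber_product (comp_left g1 g2 f1) f2).
Local Notation PR := (fiber_product f1 (comp_right g1 g2 f2)).

Let m1 (p : P1) : F := (\val p).2.
Let m2 (p : P2) : F := (\val p).1.
Let pr1 (p : P1) : L1 := (\val p).1.
Let pr2 (p : P2) : L2 := (\val p).2.

Let pb1 : is_pullback g1 f1 m1 pr1 := fiber_product_pullback_snd f1 g1.
Let pb2 : is_pullback g2 f2 m2 pr2 := fiber_product_pullback_fst g2 f2.

Let cm1 : continuous m1. Proof. by have [] := pb1. Qed.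
Let cm2 : continuous m2. Proof. by have [] := pb2. Qed.

Lemma left_matches (x : PL) : P2 (m1 (\val x).1, (\val x).2).
Proof. exact: (set_valP x). Qed.

Lemma right_matches (y : PR) : P1 ((\val y).1, m2 (\val y).2).
Proof. exact: (set_valP y). Qed.

(** In terms of the triple (x, y, z), the two halves are the pairs (y, z) and (x, y). *)
Definition left_half (x : PL) : P2 := sub_pt (left_matches x).
Definition right_half (y : PR) : P1 := sub_pt (right_matches y).

Lemma to_right_matches (x : PL) : PR (pr1 (\val x).1, left_half x).
Proof. exact: (set_valP (\val x).1). Qed.

Lemma to_left_matches (y : PR) : PL (right_half y, pr2 (\val y).2).
Proof. exact: (set_valP (\val y).2). Qed.

Definition to_right (x : PL) : PR := sub_pt (to_right_matches x).
Definition to_left (y : PR) : PL := sub_pt (to_left_matches y).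

Lemma to_rightK : cancel to_right to_left.
Proof.
move=> x; apply: val_inj; rewrite [RHS]surjective_pairing; congr pair.
by apply: val_inj; rewrite [RHS]surjective_pairing.
Qed.

Lemma to_leftK : cancel to_left to_right.
Proof.
move=> x; apply: val_inj; rewrite [RHS]surjective_pairing; congr pair.
by apply: val_inj; rewrite [RHS]surjective_pairing.
Qed.

Lemma is_bigon_to_right (u : disc R -> F) (x y : PL) :
  continuous u -> m1 (\val x).1 = u right_pt ->
  is_bigon omega2 (f := comp_left g1 g2 f1) (f' := f2) (g2 \o u) x y <->
  is_bigon omega1 (f := f1) (f' := comp_right g1 g2 f2) (g1 \o u)
    (to_right x) (to_right y).
Proof.
move=> cu xr.
have T2 := bigon_transfer_right hg2 omega2 pb2 cf2 cm1 cu (q := (\val y).1)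
  (a := left_half x) (b := left_half y) xr erefl erefl.
have T1 := bigon_transfer_left hg1 omega1 pb1 cf1 cm2 cu (p := left_half x)
  (q := left_half y) (a := (\val x).1) (b := (\val y).1) xr erefl erefl.
(* With the two forms on F identified, both transfers speak of the same conditions on u, for the
   curves m1 and m2 in F. *)
rewrite homega in T1.
have [H1 H2] := iff_trans T2 (iff_sym T1).
split=> -[h1 xy h2 h3 h4].
  have [//|k1 k2 k3 k4] := H1 _.
  by split=> // /(can_inj to_rightK).
have [//|k1 k2 k3 k4] := H2 _.
by split=> // e; apply: xy; rewrite e.
Qed.

(** The correspondence is set up as a relation: b and c are the two projections of one disc in F,
    whose value at (1,0) is fixed by the source of b. Totality and injectivity can then be shown on
    each side by the same lifting arguments, and choice turns the relation into mutually inverse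
    maps. *)
Definition same_lift (b : bigon omega2 (comp_left g1 g2 f1) f2)
    (c : bigon omega1 f1 (comp_right g1 g2 f2)) : Prop :=
  exists u : disc R -> F, [/\ continuous u,
    u right_pt = m1 (\val (bigon_src b)).1,
    bigon_map b = g2 \o u, bigon_map c = g1 \o u &
    bigon_src c = to_right (bigon_src b) /\
    bigon_tgt c = to_right (bigon_tgt b)].

Lemma bigon_map_right (X : surface R) (omega : field2 X)
    (L L' : topologicalType) (f : L -> X) (f' : L' -> X)
    (b : bigon omega f f') :
  f (\val (bigon_src b)).1 = bigon_map b right_pt /\
  f' (\val (bigon_src b)).2 = bigon_map b right_pt.
Proof. by have [_ _ _ /(_ right_pt erefl)[? [? _]] _] := bigonP b. Qed.

Lemma continuous_bigon_map (X : surface R) (omega : field2 X)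
    (L L' : topologicalType) (f : L -> X) (f' : L' -> X)
    (b : bigon omega f f') : continuous (bigon_map b).
Proof. by have [[]] := bigonP b. Qed.

Lemma same_lift_total_left b : exists c, same_lift b c.
Proof.
have [e _] := bigon_map_right b.
have cb := @continuous_bigon_map _ _ _ _ _ _ b.
have [u [cu ur gu]] := disc_lift (covering_top hg2) cb e.
have E : bigon_map b = g2 \o u by apply/funext => z; rewrite /= gu.
have := bigonP b; rewrite E.
move=> /(is_bigon_to_right _ cu (esym ur)) H.
by exists (Bigon H), u; split.
Qed.

Lemma same_lift_total_right c : exists b, same_lift b c.
Proof.
have [_ e] := bigon_map_right c.
have cb := @continuous_bigon_map _ _ _ _ _ _ c.
have [u [cu ur gu]] := disc_lift (covering_top hg1) cb e.
have E : bigon_map c = g1 \o u by apply/funext => z; rewrite /= gu.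
have := bigonP c; rewrite E -(to_leftK (bigon_src c)) -(to_leftK (bigon_tgt c)).
move=> /(is_bigon_to_right (x := to_left (bigon_src c)) _ cu (esym ur)) H.
by exists (Bigon H), u; split=> //=; rewrite !to_leftK.
Qed.

(** Both sides lift the same disc and agree at (1,0), which h fixes. The case h = id gives
    injectivity of the correspondence, general h its compatibility with reparametrization. *)
Lemma lift_disc_comp (X : surface R) (g : F -> X) (u u' : disc R -> F)
    (h : disc R -> disc R) : covering_map g ->
  continuous u -> continuous u' -> continuous h -> h right_pt = right_pt ->
  u' right_pt = u right_pt -> g \o u' = (g \o u) \o h -> u' = u \o h.
Proof.
move=> hg cu cu' ch hr ur e.
apply: (disc_lift_unique (covering_top hg)) => //.
- by move=> z; apply: continuous_comp; [exact: ch|exact: cu].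
- by move=> z; exact: (congr1 (@^~ z) e).
- by rewrite /= hr.
Qed.

Lemma same_lift_inj_left b b' c : same_lift b c -> same_lift b' c -> b = b'.
Proof.
move=> [u [cu ur ub uc [sc tc]]] [u' [cu' ur' ub' uc' [sc' tc']]].
have es : bigon_src b = bigon_src b'.
  by apply: (can_inj to_rightK); rewrite -sc.
have et : bigon_tgt b = bigon_tgt b'.
  by apply: (can_inj to_rightK); rewrite -tc.
apply: bigon_eq => //; rewrite ub ub'; congr (_ \o _).
apply: (lift_disc_comp (h := id) hg1) => //; last by rewrite -uc -uc'.
  by move=> z; exact: cvg_id.
by rewrite ur ur' es.
Qed.

Lemma same_lift_inj_right b c c' : same_lift b c -> same_lift b c' -> c = c'.
Proof.
move=> [u [cu ur ub uc [sc tc]]] [u' [cu' ur' ub' uc' [sc' tc']]].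
apply: bigon_eq; rewrite ?sc ?sc' ?tc ?tc' // uc uc'; congr (_ \o _).
apply: (lift_disc_comp (h := id) hg2) => //; last by rewrite -ub -ub'.
  by move=> z; exact: cvg_id.
by rewrite ur ur'.
Qed.

Lemma same_lift_same_bigon b c b' c' : same_lift b c -> same_lift b' c' ->
  same_bigon c c' <-> same_bigon b b'.
Proof.
move=> [u [cu ur ub uc [sc tc]]] [u' [cu' ur' ub' uc' [sc' tc']]].
split=> -[h [k [ch ck hk kh [fix_h up eb es et]]]];
  exists h, k; split=> //; split=> //.
- have hr : h right_pt = right_pt by apply: fix_h; left.
  have es' : bigon_src b' = bigon_src b.
    by apply: (can_inj to_rightK); rewrite -sc -sc'.
  rewrite ub ub' -compA; congr (_ \o _); apply: (lift_disc_comp hg1) => //.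
    by rewrite ur ur' es'.
  by rewrite -uc -uc'.
- by apply: (can_inj to_rightK); rewrite -sc -sc'.
- by apply: (can_inj to_rightK); rewrite -tc -tc'.
- have hr : h right_pt = right_pt by apply: fix_h; left.
  rewrite uc uc' -compA; congr (_ \o _); apply: (lift_disc_comp hg2) => //.
    by rewrite ur ur' es.
  by rewrite -ub -ub'.
- by rewrite sc sc' es.
- by rewrite tc tc' et.
Qed.

Lemma bigon_bijection :
  exists Phi : bigon omega2 (comp_left g1 g2 f1) f2 ->
               bigon omega1 f1 (comp_right g1 g2 f2),
    bijective Phi /\
    (forall b, bigon_src (Phi b) = to_right (bigon_src b) /\
               bigon_tgt (Phi b) = to_right (bigon_tgt b)) /\
    (forall b b', same_bigon (Phi b) (Phi b') <-> same_bigon b b').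
Proof.
have /choice[Phi PhiP] := same_lift_total_left.
have /choice[Psi PsiP] := same_lift_total_right.
exists Phi; split; [exists Psi|split].
- by move=> b; exact: same_lift_inj_left (PsiP (Phi b)) (PhiP b).
- by move=> c; exact: same_lift_inj_right (PhiP (Psi c)) (PsiP c).
- by move=> b; have [u []] := PhiP b.
- by move=> b b'; exact: same_lift_same_bigon.
Qed.

End Correspondence.

Theorem theorem9p3 (R : realType) (F F1 F2 : surface R)
    (hF : closed_surface F) (hF1 : closed_surface F1) (hF2 : closed_surface F2)
    (omega1 : field2 F1) (omega2 : field2 F2)
    (homega1 : symplectic omega1) (homega2 : symplectic omega2)
    (g1 : F -> F1) (g2 : F -> F2)
    (hg : lagrangian_immersion (M := F) (X := prod_manifold F1 F2)
            (prod_form omega1 omega2) (fun y => (g1 y, g2 y)))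
    (hg1 : covering_map g1) (hg2 : covering_map g2)
    (L1 L2 : curve R) (f1 : L1 -> F1) (f2 : L2 -> F2)
    (hf1 : immersed_curve f1) (hf2 : immersed_curve f2) :
  composable_left g1 g2 f1 /\
  composable_right g1 g2 f2 /\
  exists beta : fiber_product (comp_left g1 g2 f1) f2 ->
                fiber_product f1 (comp_right g1 g2 f2),
    bijective beta /\
    (forall p, triple_right (beta p) = triple_left p) /\
    exists Phi : bigon omega2 (comp_left g1 g2 f1) f2 ->
                 bigon omega1 f1 (comp_right g1 g2 f2),
      bijective Phi /\
      (forall b, bigon_src (Phi b) = beta (bigon_src b) /\
                 bigon_tgt (Phi b) = beta (bigon_tgt b)) /\
      (forall b b', same_bigon (Phi b) (Phi b') <-> same_bigon b b').
Proof.
have [_ _ [sf1 _]] := hf1; have [_ _ [sf2 _]] := hf2.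
have cf1 : continuous f1 by move=> x; exact: sf1.1.
have cf2 : continuous f2 by move=> x; exact: sf2.1.
split; first exact: covering_composable_left.
split; first exact: covering_composable_right.
exists (@to_right _ _ _ _ _ _ g1 g2 f1 f2); split.
  exists (@to_left _ _ _ _ _ _ g1 g2 f1 f2); [exact: to_rightK|exact: to_leftK].
split=> //; apply: bigon_bijection => //.
exact: lagrangian_pullback_eq hg.
Qed.
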